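(* Let $\epsilon>0$, $c_1=\frac{1}{12\epsilon}$, and let $q_1,q_2,q_3:\mathbb{R}\to\mathbb{C}$ be continuous and absolutely integrable. Let $J_\pm(x,\lambda)$ be the associated Jost solutions, $S(\lambda)=(s_{kj})_{4\times 4}$ the scattering matrix, and $R(\lambda)=(r_{kj})_{4\times4}=S^{-1}(\lambda)$ for $\lambda\in\mathbb{R}$. Let $$P_1=\left([J_-]_1,[J_+]_2,[J_+]_3,[J_+]_4\right),\qquad P_2=\begin{pmatrix}[J_-^{-1}]^1\\ [J_+^{-1}]^2\\ [J_+^{-1}]^3\\ [J_+^{-1}]^4\end{pmatrix},$$ where $[A]_j$ is the $j$-th column and $[A]^j$ the $j$-th row of $A$, with $P_1$ extended to the upper half-plane $\mathbb{C}^+$ and $P_2$ extended to the lower half-plane $\mathbb{C}^-$. Write $P^+$ for $P_1$ (with its limit on the real axis from $\mathbb{C}^+$) and $P^-$ for $P_2$ (with its limit on the real axis from $\mathbb{C}^-$). Then, for every $x\in\mathbb{R}$: (i) $P^\pm(x,\cdot)$ is analytic in $\mathbb{C}^\pm$; (ii) $P^-(x,\lambda)P^+(x,\lambda)=G(x,\lambda)$ for $\lambda\in\mathbb{R}$, where $$G(x,\lambda)=\begin{pmatrix}1 & r_{12}e^{-3ic_1\lambda x} & r_{13}e^{-3ic_1\lambda x} & r_{14}e^{-3ic_1\lambda x}\\ s_{21}e^{3ic_1\lambda x} & 1 & 0 & 0\\ s_{31}e^{3ic_1\lambda x} & 0 & 1 & 0\\ s_{41}e^{3ic_1\lambda x}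 & 0 & 0 & 1\end{pmatrix};$$ (iii) $P^\pm(x,\lambda)\to\mathbb{I}$ as $\lambda\to\infty$ (in the respective closed half-plane).
   Context: $\mathbb{I}$ is the $4\times4$ identity, $\mathbb{C}^{\pm}=\{\lambda:\pm\operatorname{Im}\lambda>0\}$, $^*$ is complex conjugation, $\sigma=\operatorname{diag}(-2,1,1,1)$, and $$Q(x)=\begin{pmatrix}0&-q_1&-q_2&-q_3\\ q_1^*&0&0&0\\ q_2^*&0&0&0\\ q_3^*&0&0&0\end{pmatrix}.$$ (The $q_i$ may also depend on a time parameter $t$, which is fixed and suppressed.) For $\lambda\in\mathbb{R}$ the Jost solutions $J_\pm(x,\lambda)$ are the $4\times4$ matrix solutions of $J_x=ic_1\lambda[\sigma,J]+QJ$ (with $[\sigma,J]=\sigma J-J\sigma$) satisfying $J_\pm\to\mathbb{I}$ as $x\to\pm\infty$; equivalently they are the bounded solutions of the Volterra equations $$J_-(x,\lambda)=\mathbb{I}+\int_{-\infty}^xe^{ic_1\lambda\sigma(x-y)}Q(y)J_-(y,\lambda)e^{-ic_1\lambda\sigma(x-y)}\,dy,$$ $$J_+(x,\lambda)=\mathbb{I}-\int_x^{+\infty}e^{ic_1\lambda\sigma(x-y)}Q(y)J_+(y,\lambda)e^{-ic_1\lambda\sigma(x-y)}\,dy.$$ They are invertible. The scattering matrix $S(\lambda)$, $\lambda\in\mathbb{R}$, is the ($x$-independent) matrix with $J_-E=J_+ES(\lambda)$, where $E=e^{ic_1\lambda\sigma x}$. A function of $\lambda\in\mathbb{R}$ is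 said to extend analytically to $\mathbb{C}^{\pm}$ if it is the restriction to $\mathbb{R}$ of a continuous function on the closed half-plane $\mathbb{C}^\pm\cup\mathbb{R}$ that is analytic in $\mathbb{C}^\pm$; the columns $[J_-]_1,[J_+]_2,[J_+]_3,[J_+]_4$ extend in this sense to $\mathbb{C}^+$ and the rows $[J_-^{-1}]^1,[J_+^{-1}]^2,[J_+^{-1}]^3,[J_+^{-1}]^4$ to $\mathbb{C}^-$. *)

(* Defs.v *)
From HB Require Import structures.
From mathcomp Require Import all_boot all_order all_algebra.
From mathcomp Require Import all_classical all_reals all_analysis.
From mathcomp Require Import complex.
Set Implicit Arguments.
Unset Strict Implicit.
Unset Printing Implicit Defensive.
Import Order.TTheory GRing.Theory Num.Theory.
Import numFieldNormedType.Exports.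
Local Open Scope classical_set_scope.
Local Open Scope ring_scope.
Local Open Scope complex_scope.

Section Scattering.
Context {R : realType}.

(* The regular module [R[i]^o] carries the topology, the norm and the complex
   derivative, which [R[i]] alone does not have. *)
Local Notation C := (R[i]^o).

(* exp(i t) for real t *)
Definition expi (t : R) : R[i] := cos t +i* sin t.

(* A complex-valued function of a real variable is differentiated through its
   real and imaginary parts. *)
Definition is_derive_cplx (f : R -> R[i]) (x : R) (d : R[i]) : Prop :=
  is_derive x 1 (fun y => complex.Re (f y)) (complex.Re d) /\
  is_derive x 1 (fun y => complex.Im (f y)) (complex.Im d).

Definition abs_integrable (f : R -> R[i]) : Prop :=
  (@lebesgue_measure R).-integrable setT (fun x => (Normc.normc (f x))%:E).

Definition sigma_row : 'rV[R]_4 := \row_(j < 4) (if j == 0 then - 2 else 1).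

Definition sigma : 'M[R[i]]_4 := diag_mx (map_mx (real_complex R) sigma_row).

(* The components q_1, q_2, q_3 are q 0, q 1, q 2; the blocks have sizes 1
   and 3. *)
Definition Qmx (q : 'I_3 -> R -> R[i]) (x : R) : 'M[R[i]]_4 :=
  block_mx (0 : 'M[R[i]]_1) (\row_(j < 3) (- q j x))
           (\col_(k < 3) (q k x)^*) (0 : 'M[R[i]]_3).

(* E(x, l) = exp(i c1 l sigma x) *)
Definition Emx (c1 x l : R) : 'M[R[i]]_4 :=
  diag_mx (\row_(j < 4) expi (c1 * l * sigma_row 0 j * x)).

(* [J] is the Jost solution normalised at the end [F] of the real line,
   [F] being [-oo] or [+oo]. *)
Definition is_jost (c1 : R) (q : 'I_3 -> R -> R[i]) (F : set_system R)
    (J : R -> R -> 'M[R[i]]_4) : Prop :=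
  forall l : R,
    (forall (x : R) (k j : 'I_4),
      is_derive_cplx (fun y => J y l k j) x
        (((0 +i* (c1 * l)) *: (sigma *m J x l - J x l *m sigma)
          + Qmx q x *m J x l) k j)) /\
    (forall k j : 'I_4,
      (fun x => J x l k j : C) @ F --> ((1%:M : 'M[R[i]]_4) k j : C)).

Definition is_scattering (c1 : R) (Jm Jp : R -> R -> 'M[R[i]]_4)
    (S : R -> 'M[R[i]]_4) : Prop :=
  forall x l : R, Jm x l *m Emx c1 x l = Jp x l *m Emx c1 x l *m S l.

Definition P1 (Jm Jp : R -> R -> 'M[R[i]]_4) (x l : R) : 'M[R[i]]_4 :=
  \matrix_(k < 4, j < 4) (if j == 0 then Jm x l k j else Jp x l k j).

Definition P2 (Jm Jp : R -> R -> 'M[R[i]]_4) (x l : R) : 'M[R[i]]_4 :=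
  \matrix_(k < 4, j < 4)
    (if k == 0 then invmx (Jm x l) k j else invmx (Jp x l) k j).

Definition Gmx (c1 : R) (S : R -> 'M[R[i]]_4) (x l : R) : 'M[R[i]]_4 :=
  \matrix_(k < 4, j < 4)
    (if k == j then 1
     else if k == 0 then invmx (S l) k j * expi (- (3 * c1 * l * x))
     else if j == 0 then S l k j * expi (3 * c1 * l * x)
     else 0).

Definition upper_half : set C := [set z | 0 < complex.Im z].
Definition closed_upper_half : set C := [set z | 0 <= complex.Im z].
Definition lower_half : set C := [set z | complex.Im z < 0].
Definition closed_lower_half : set C := [set z | complex.Im z <= 0].

Definition analytic_in (U : set C) (P : C -> 'M[R[i]]_4) : Prop :=
  forall (z : C) (k j : 'I_4), U z -> derivable (fun w : C => P w k j : C) z 1.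

(* [clU] is a closed half-plane bounded by the real line; the values of [P]
   outside [clU] are irrelevant. *)
Definition continuous_extension (clU : set C) (P0 : R -> 'M[R[i]]_4)
    (P : C -> 'M[R[i]]_4) : Prop :=
  (forall l : R, P l%:C = P0 l) /\
  (forall k j : 'I_4, {within clU, continuous (fun w : C => P w k j : C)}).

(* The filter of z tending to infinity inside [A] *)
Definition infty_in (A : set C) : set_system C :=
  filter_from setT (fun M : R => [set z | A z /\ M < Normc.normc z]).

Definition tends_to_id_in (A : set C) (P : C -> 'M[R[i]]_4) : Prop :=
  forall k j : 'I_4,
    (fun w : C => P w k j : C) @ infty_in A --> ((1%:M : 'M[R[i]]_4) k j : C).

End Scattering.

(* Main.v *)
Require Import Defs.
From HB Require Import structures.
From mathcomp Require Import all_boot all_order all_algebra.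
From mathcomp Require Import all_classical all_reals all_analysis.
From mathcomp Require Import complex ring lra.
Import Order.TTheory GRing.Theory Num.Theory.
Import numFieldNormedType.Exports.
Local Open Scope classical_set_scope.
Local Open Scope ring_scope.
Local Open Scope complex_scope.
Set Implicit Arguments.
Unset Strict Implicit.
Unset Printing Implicit Defensive.

(* For real [l] the matrix [Q] is antihermitian, so the Jost solutions are
   unitary; hence [P2] is the adjoint of [P1] and [P^-(l) = (P^+(l^* ))^*]
   extends to the lower half-plane as soon as [P^+] extends to the upper one.

   A column of [P^+] (after [x -> - x] for those of [J_+]) solves
   [g' = kappa D g + A g] with [g -> e] at [-oo], where [kappa = 3 i c1 l] has
   nonpositive real part in the closed upper half-plane, [D] is a diagonal
   projection with [D e = 0], and [A] is dominated by an integrable density [m].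
   Picard iteration in a weighted norm gives a solution for every such [l], and
   the energy estimate [N' <= 9 m (N + eps^2)] for [N = |g|^2], uniform in
   [kappa], gives uniqueness and continuity in [l].  Analyticity follows by
   comparing the difference quotient with the solution of the differentiated
   equation, and the limit at infinity by a Riemann-Lebesgue argument for the
   component [D A e] of the source. *)

(** * Real calculus *)

Section RealCalculus.
Context {R : realType}.
Implicit Types (f g : R -> R) (x y a b : R).

(** The Jost solutions are given on the real axis only, so the extension is built afresh, column by
    column, and glued to the given columns on the axis by uniqueness. The 3 in [kappa] is the gap
    between the eigenvalues -2 and 1 of [sigma]. It enters as +3 in the first column of [J_-] and as
    -3 in the other columns of [J_+], where the reflection restores the sign: this is why these four
    columns share one half-plane. The rates grow with [l], so no estimate may contain their size;
    they act only through the sign of their real part. The potential is merely integrable, and on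
    the real axis the product of a solution with a change of rate need not be integrable at [-oo].
    Continuity up to the axis and differentiability inside therefore need separate arguments, the
    second one relying on the strict damping available for [Im l > 0]. At infinity the limit is [e]
    because [Q] couples the index 0 only with the three others: the source [A e] has no component
    outside [D], and inside [D] the large rate averages it out. *)

Lemma der_add f g x a b : is_derive x 1 f a -> is_derive x 1 g b ->
  is_derive x 1 (fun y => f y + g y) (a + b).
Proof. by move=> fa gb; exact: is_deriveD. Qed.

Lemma der_opp f x a : is_derive x 1 f a -> is_derive x 1 (fun y => - f y) (- a).
Proof. by move=> fa; exact: is_deriveN. Qed.

Lemma der_sub f g x a b : is_derive x 1 f a -> is_derive x 1 g b ->
  is_derive x 1 (fun y => f y - g y) (a - b).
Proof. by move=> fa gb; exact: is_deriveB. Qed.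

Lemma der_mul f g x a b : is_derive x 1 f a -> is_derive x 1 g b ->
  is_derive x 1 (fun y => f y * g y) (a * g x + f x * b).
Proof.
move=> fa gb; apply: is_derive_eq (is_deriveM _ _) _ => /=.
by rewrite addrC; congr (_ + _); rewrite [LHS]mulrC.
Qed.

Lemma der_comp f g x a b : is_derive x 1 g b -> is_derive (g x) 1 f a ->
  is_derive x 1 (fun y => f (g y)) (a * b).
Proof. by move=> gb fa; apply: is_derive_eq (is_derive1_comp _ _) _ => /=. Qed.

Lemma der_cst x a : is_derive x 1 (fun=> a) 0.
Proof. exact: is_derive_cst. Qed.

Lemma der_id x : is_derive x 1 (fun y : R => y) 1.
Proof. exact: is_derive_id. Qed.

Lemma der_scale k f x a : is_derive x 1 f a -> is_derive x 1 (fun y => k * f y) (k * a).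
Proof.
by move=> fa; apply: is_derive_eq (der_mul (der_cst x k) fa) _; rewrite mul0r add0r.
Qed.

Lemma der_linear k x : is_derive x 1 (fun y => k * y) k.
Proof. by apply: is_derive_eq (der_scale k (der_id x)) _; rewrite mulr1. Qed.

Lemma der_expR f x a : is_derive x 1 f a ->
  is_derive x 1 (fun y => expR (f y)) (expR (f x) * a).
Proof. by move=> fa; apply: der_comp. Qed.

Lemma der_sum (I : Type) (r : seq I) (F : I -> R -> R) (dF : I -> R) x :
  (forall i, is_derive x 1 (F i) (dF i)) ->
  is_derive x 1 (fun y => \sum_(i <- r) F i y) (\sum_(i <- r) dF i).
Proof.
move=> dFi; elim: r => [|i r IH].
  by rewrite big_nil; under eq_fun do rewrite big_nil; exact: der_cst.
by rewrite big_cons; under eq_fun do rewrite big_cons; exact: der_add.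
Qed.

Lemma der_cont f : (forall x, exists a, is_derive x 1 f a) -> continuous f.
Proof.
move=> fd x; have [a fa] := fd x.
by apply/differentiable_continuous/derivable1_diffP; case: fa.
Qed.

Lemma der_nincr f df a b : a <= b ->
  (forall y, a <= y <= b -> is_derive y 1 f (df y)) ->
  (forall y, a <= y <= b -> df y <= 0) -> f b <= f a.
Proof.
move=> ab fd df0.
have [y| |c cab E] := @MVT_segment R f df a b ab.
- by rewrite in_itv => /andP[ay yb]; apply: fd; rewrite !ltW.
- apply: derivable_within_continuous => y; rewrite in_itv => yab.
  by case: (fd y yab).
- rewrite -subr_le0 E; rewrite in_itv /= in cab.
  by rewrite mulr_le0_ge0 ?subr_ge0 ?df0.
Qed.

Lemma der_ndecr f df a b : a <= b ->
  (forall y, a <= y <= b -> is_derive y 1 f (df y)) ->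
  (forall y, a <= y <= b -> 0 <= df y) -> f a <= f b.
Proof.
move=> ab fd df0; rewrite -lerN2.
apply: (@der_nincr (fun y => - f y) (fun y => - df y) a b ab) => y yab.
  exact/der_opp/fd.
by rewrite oppr_le0 df0.
Qed.

(** The integral from [a] is differentiated only to the right of [a], so the base point [al x] moves
    with [x]. Subtracting the value at 0 makes the result independent of the base point, which can
    then be frozen near each [x]. *)
Lemma antiderivative f : continuous f -> exists F, forall x, is_derive x 1 F (f x).
Proof.
move=> fc; pose I a x := (\int[@lebesgue_measure R]_(t in `[a, x]) f t)%R.
have dI a x : a < x -> is_derive x 1 (I a) (f x).
  move=> ax; have xx1 : x < x + 1 by rewrite ltrDl.
  have intf : (@lebesgue_measure R).-integrable `[a, x + 1] (EFin \o f).
    apply: continuous_compact_integrable; first exact: segment_compact.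
    exact/continuous_subspaceT.
  have [dI <-] := continuous_FTC1_closed xx1 intf ax (fc x).
  by rewrite derive1E; apply: derivableP.
have indep a b x : a < Num.min x 0 -> b < Num.min x 0 ->
    I a x - I a 0 = I b x - I b 0.
  move=> am bm.
  pose g y := I a y - I b y.
  have dg y : Num.min x 0 <= y -> is_derive y 1 g 0.
    move=> my; rewrite -(subrr (f y)).
    by apply: der_sub; apply: dI; exact: lt_le_trans my.
  have geq u v : Num.min x 0 <= u -> u <= v -> g v = g u.
    move=> mu uv; apply/eqP; rewrite eq_le; apply/andP; split.
      apply: (@der_nincr g (fun=> 0)) => // y /andP[uy _]; apply: dg.
      exact: le_trans uy.
    apply: (@der_ndecr g (fun=> 0)) => // y /andP[uy _]; apply: dg.
    exact: le_trans uy.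
  suff : g x = g 0 by rewrite /g; lra.
  rewrite (geq (Num.min x 0) x) ?(geq (Num.min x 0) 0) ?lexx//.
    by rewrite ge_min lexx orbT.
  by rewrite ge_min lexx.
pose al x := Num.min x 0 - 1.
exists (fun x => I (al x) x - I (al x) 0) => x.
(* The offset 2 keeps [a] below [Num.min y 0] for every [y > x - 1]. *)
pose a := Num.min x 0 - 2.
have mx : Num.min x 0 <= x by rewrite ge_min lexx.
have m0 : Num.min x 0 <= 0 by rewrite ge_min lexx orbT.
have ax : a < x by rewrite /a; lra.
apply: (@near_eq_is_derive _ _ _ (fun y => I a y - I a 0)).
- near=> y; apply: indep; last by rewrite /al; lra.
  have yx : x - 1 < y by near: y; apply: lt_nbhsr; lra.
  by rewrite lt_min /a; apply/andP; split; lra.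
- by have := der_sub (dI a x ax) (der_cst x (I a 0)); rewrite subr0.
Unshelve. all: by end_near. Qed.


Definition vanishing f := forall e, 0 < e -> exists A, forall y, y <= A -> `|f y| <= e.

(* [m] is integrable near [-oo] and [M] is its primitive vanishing there; every
   integral below is replaced by such a pair and a comparison of derivatives. *)
Record density (m M : R -> R) : Prop := Density {
  density_der : forall x, is_derive x 1 M (m x);
  density_cont : continuous m;
  density_ge0 : forall x, 0 <= m x;
  density_van : vanishing M;
  density_bnd : exists B, forall x, M x <= B }.

Lemma density_le m M : density m M -> {homo M : x y / x <= y}.
Proof.
move=> [dM _ m0 _ _] x y xy.
by apply: (@der_ndecr M m) => // z _; apply: dM.
Qed.

Lemma density_prim_ge0 m M : density m M -> forall x, 0 <= M x.
Proof.
move=> dm x; apply/ler_addgt0Pr => e e0.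
have [A hA] := density_van dm e0.
have := hA (Num.min A x); rewrite ge_min lexx => /(_ isT).
have := density_le dm (_ : Num.min A x <= x); rewrite ge_min lexx orbT => /(_ isT).
by move=> h1; rewrite ler_norml => /andP[h2 h3]; lra.
Qed.

(** On the negative axis [F + C * M] is nondecreasing and [F - C * M] nonincreasing. The first is
    thus bounded below and tends to its infimum at [-oo]; as [M] vanishes there, so does [F] minus
    that infimum. *)
Lemma vanishing_primitive m M f (C : R) : density m M -> continuous f ->
  0 <= C -> (forall x, x <= 0 -> `|f x| <= C * m x) ->
  exists F, (forall x, is_derive x 1 F (f x)) /\ vanishing F.
Proof.
move=> dm fc C0 fm; have [F dF] := antiderivative fc.
pose G := fun x => F x + C * M x.
have M0 := density_prim_ge0 dm.
have dCM x : is_derive x 1 (fun y => C * M y) (C * m x).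
  exact: (der_scale _ (density_der dm _)).
have Gnd x y : x <= y -> y <= 0 -> G x <= G y.
  move=> xy y0; apply: (@der_ndecr G (fun x => f x + C * m x)) => // z /andP[_ zy].
  by have := fm z (le_trans zy y0); rewrite ler_norml; lra.
have Fni x : x <= 0 -> F 0 - C * M 0 <= F x - C * M x.
  move=> x0; apply: (@der_nincr (fun x => F x - C * M x) (fun x => f x - C * m x)) => // z /andP[_ zy].
  by have := fm z zy; rewrite ler_norml; lra.
have CM0 x : 0 <= C * M x by rewrite mulr_ge0.
pose E := [set G x | x in [set x | x <= 0]].
have hE : has_inf E.
  split; first by exists (G 0), 0 => /=.
  exists (F 0 - C * M 0) => _ [x /= x0 <-].
  by have := Fni x x0; have := CM0 x; rewrite /G; lra.
exists (fun x => F x - inf E); split.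
  by move=> x; apply: is_derive_eq (der_sub (dF x) (der_cst x _)) _; rewrite subr0.
move=> e e0; have [_ [a /= a0 <-] Ga] := inf_adherent e0 hE.
have e1 : 0 < e / (C + 1) by rewrite divr_gt0// ltr_wpDl.
have [A hA] := density_van dm e1.
exists (Num.min A a) => y; rewrite le_min => /andP[yA ya].
have := Gnd y a ya a0.
have : inf E <= G y by apply: ge_inf; [case: hE | exists y => //=; exact: le_trans ya a0].
have := hA y yA; rewrite ger0_norm// ler_pdivlMr ?ltr_wpDl// => h.
have h2 : C * M y <= e by have := M0 y; lra.
by have := CM0 y; rewrite /G ler_norml => *; rewrite /G in Ga; apply/andP; split; lra.
Qed.

End RealCalculus.

(** * Complex-valued functions of a real variable *)

Section ComplexCalculus.
Context {R : realType}.
Local Notation C := R[i].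
Local Notation Re := complex.Re.
Local Notation Im := complex.Im.
Local Notation nc := Normc.normc.
Implicit Types (f g : R -> C) (x y : R) (z : C).

Lemma ReM z w : Re (z * w) = Re z * Re w - Im z * Im w :> R.
Proof. by case: z; case: w. Qed.

Lemma ImM z w : Im (z * w) = Re z * Im w + Im z * Re w :> R.
Proof. by case: z; case: w. Qed.

Lemma ReD z w : Re (z + w) = Re z + Re w :> R.
Proof. by case: z; case: w. Qed.

Lemma ImD z w : Im (z + w) = Im z + Im w :> R.
Proof. by case: z; case: w. Qed.

Lemma ReN z : Re (- z) = - Re z :> R.
Proof. by case: z. Qed.

Lemma ImN z : Im (- z) = - Im z :> R.
Proof. by case: z. Qed.

Lemma ReJ z : Re z^* = Re z :> R.
Proof. by case: z. Qed.

Lemma ImJ z : Im z^* = - Im z :> R.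
Proof. by case: z. Qed.

Definition ReImE := (ReM, ImM, ReD, ImD, ReN, ImN, ReJ, ImJ).

Lemma Re_sum (I : Type) (r : seq I) (F : I -> C) :
  Re (\sum_(i <- r) F i) = \sum_(i <- r) Re (F i).
Proof. by elim/big_ind2 : _ => // z a w b <- <-; rewrite ReD. Qed.

Lemma complex_eq z w : Re z = Re w :> R -> Im z = Im w :> R -> z = w.
Proof. by case: z => a b; case: w => c d /= -> ->. Qed.

Lemma normc_sqr z : nc z ^+ 2 = Re z ^+ 2 + Im z ^+ 2.
Proof. by case: z => a b /=; rewrite sqr_sqrtr// addr_ge0 ?sqr_ge0. Qed.

Lemma normc_ge0 z : 0 <= nc z.
Proof. by case: z => a b; exact: sqrtr_ge0. Qed.

Lemma normr_Re_le z : `|Re z| <= nc z.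
Proof.
rewrite -(@ler_pXn2r _ 2) ?nnegrE ?normc_ge0//.
by rewrite normc_sqr real_normK ?num_real// lerDl sqr_ge0.
Qed.

Lemma normr_Im_le z : `|Im z| <= nc z.
Proof.
rewrite -(@ler_pXn2r _ 2) ?nnegrE ?normc_ge0//.
by rewrite normc_sqr real_normK ?num_real// lerDr sqr_ge0.
Qed.

Lemma normc_le_ReIm z : nc z <= `|Re z| + `|Im z|.
Proof.
rewrite -(@ler_pXn2r _ 2) ?nnegrE ?normc_ge0 ?addr_ge0//.
rewrite normc_sqr sqrrD !real_normK ?num_real//.
by rewrite addrAC lerDl mulrn_wge0// mulr_ge0.
Qed.

Lemma normc_real x : nc x%:C = `|x|.
Proof. by rewrite /= expr0n addr0 sqrtr_sqr. Qed.

Lemma normcJ z : nc z^* = nc z.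
Proof. by case: z => a b /=; rewrite sqrrN. Qed.

Lemma normc_triB z w : nc z <= nc (z - w) + nc w.
Proof. by rewrite -{1}(subrK w z) le_normcD. Qed.

Lemma normc_sum (I : Type) (r : seq I) (F : I -> C) :
  nc (\sum_(i <- r) F i) <= \sum_(i <- r) nc (F i).
Proof.
elim/big_ind2 : _ => //; first by rewrite Normc.normc0.
by move=> z a w b za wb; apply: le_trans (le_normcD _ _) _; apply: lerD.
Qed.

Lemma normc_eq0 z : nc z <= 0 -> z = 0.
Proof.
by move=> z0; apply: Normc.eq0_normc; apply/eqP; rewrite eq_le z0 normc_ge0.
Qed.

Lemma Re_normcM z w : Re (z^* * w) <= nc z * nc w.
Proof.
rewrite -(normcJ z) -Normc.normcM; apply: le_trans (ler_norm _) _.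
exact: normr_Re_le.
Qed.

Lemma cder_eq f x d e : is_derive_cplx f x d -> d = e -> is_derive_cplx f x e.
Proof. by move=> fd <-. Qed.

Lemma cder_ext f g x d : (forall y, f y = g y) ->
  is_derive_cplx f x d -> is_derive_cplx g x d.
Proof. by move=> /funext ->. Qed.

Lemma cder_cst z x : is_derive_cplx (fun=> z) x 0.
Proof. by split; exact: der_cst. Qed.

Lemma cder_add f g x d e : is_derive_cplx f x d -> is_derive_cplx g x e ->
  is_derive_cplx (fun y => f y + g y) x (d + e).
Proof.
move=> [fr fi] [gr gi]; split; rewrite ?ReD ?ImD.
  by under eq_fun do rewrite ReD; exact: der_add.
by under eq_fun do rewrite ImD; exact: der_add.
Qed.

Lemma cder_opp f x d : is_derive_cplx f x d ->
  is_derive_cplx (fun y => - f y) x (- d).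
Proof.
move=> [fr fi]; split; rewrite ?ReN ?ImN.
  by under eq_fun do rewrite ReN; exact: der_opp.
by under eq_fun do rewrite ImN; exact: der_opp.
Qed.

Lemma cder_sub f g x d e : is_derive_cplx f x d -> is_derive_cplx g x e ->
  is_derive_cplx (fun y => f y - g y) x (d - e).
Proof. by move=> fd ge; apply: cder_add fd (cder_opp ge). Qed.

Lemma cder_mul f g x d e : is_derive_cplx f x d -> is_derive_cplx g x e ->
  is_derive_cplx (fun y => f y * g y) x (d * g x + f x * e).
Proof.
move=> [fr fi] [gr gi]; split.
  under eq_fun do rewrite ReM.
  apply: is_derive_eq (der_sub (der_mul fr gr) (der_mul fi gi)) _.
  by rewrite !ReImE; ring.
under eq_fun do rewrite ImM.
apply: is_derive_eq (der_add (der_mul fr gi) (der_mul fi gr)) _.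
by rewrite !ReImE; ring.
Qed.

Lemma cder_scale z f x d : is_derive_cplx f x d ->
  is_derive_cplx (fun y => z * f y) x (z * d).
Proof.
by move=> fd; apply: cder_eq (cder_mul (cder_cst z x) fd) _; rewrite mul0r add0r.
Qed.

Lemma cder_conj f x d : is_derive_cplx f x d ->
  is_derive_cplx (fun y => (f y)^*) x d^*.
Proof.
move=> [fr fi]; split; rewrite ?ReJ ?ImJ.
  by under eq_fun do rewrite ReJ.
by under eq_fun do rewrite ImJ; exact: der_opp.
Qed.

Lemma cder_sum (I : Type) (r : seq I) (F : I -> R -> C) (dF : I -> C) x :
  (forall i, is_derive_cplx (F i) x (dF i)) ->
  is_derive_cplx (fun y => \sum_(i <- r) F i y) x (\sum_(i <- r) dF i).
Proof.
move=> dFi; elim: r => [|i r IH].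
  rewrite big_nil; apply: cder_ext (cder_cst 0 x) => y; by rewrite big_nil.
rewrite big_cons; apply: cder_ext (cder_add (dFi i) IH) => y.
by rewrite big_cons.
Qed.

Lemma cder_reflect f x d : is_derive_cplx f (- x) d ->
  is_derive_cplx (fun y => f (- y)) x (- d).
Proof.
move=> [fr fi]; have dN := der_opp (der_id x).
split.
  apply: is_derive_eq (der_comp dN fr) _; by rewrite ReN mulrN1.
apply: is_derive_eq (der_comp dN fi) _; by rewrite ImN mulrN1.
Qed.

Lemma der_normc_sqr f x d : is_derive_cplx f x d ->
  is_derive x 1 (fun y => nc (f y) ^+ 2) (2 * Re ((f x)^* * d)).
Proof.
move=> [fr fi]; under eq_fun do rewrite normc_sqr !expr2.
apply: is_derive_eq (der_add (der_mul fr fr) (der_mul fi fi)) _.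
by rewrite !ReImE; ring.
Qed.

Definition cexp z : C := (expR (Re z) * cos (Im z)) +i* (expR (Re z) * sin (Im z)).

Lemma cexpE z : cexp z = (expR (Re z) * cos (Im z)) +i* (expR (Re z) * sin (Im z)).
Proof. by []. Qed.

Lemma cexpN z : cexp z * cexp (- z) = 1.
Proof.
have h : cos (Im z) ^+ 2 + sin (Im z) ^+ 2 = 1 := cos2Dsin2 _.
have e : expR (Re z) * expR (- Re z) = 1 by rewrite -expRD subrr expR0.
rewrite !cexpE ReN ImN cosN sinN; apply: complex_eq => /=; last by ring.
transitivity (expR (Re z) * expR (- Re z) * (cos (Im z) ^+ 2 + sin (Im z) ^+ 2)).
  by ring.
by rewrite h e mulr1.
Qed.

Lemma normc_cexp z : nc (cexp z) = expR (Re z).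
Proof.
apply/eqP; rewrite -(@eqrXn2 _ 2) ?normc_ge0 ?expR_ge0// normc_sqr /=.
by rewrite !exprMn -mulrDr cos2Dsin2 mulr1.
Qed.

Lemma cder_cexp z x : is_derive_cplx (fun y => cexp (z * y%:C)) x (z * cexp (z * x%:C)).
Proof.
have dl a : is_derive x 1 (fun y => a * y) a by exact: der_linear.
have e w : cexp (z * w%:C) = (expR (Re z * w) * cos (Im z * w)) +i* (expR (Re z * w) * sin (Im z * w)).
  by rewrite cexpE !ReImE /= !mulr0 subr0 add0r.
have dc := der_comp (dl (Im z)) (is_derive_cos (Im z * x)).
have ds := der_comp (dl (Im z)) (is_derive_sin (Im z * x)).
have de := der_expR (dl (Re z)).
rewrite e; split; under eq_fun do rewrite e /=.
  apply: is_derive_eq (der_mul de dc) _; rewrite ReM /=; ring.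
apply: is_derive_eq (der_mul de ds) _; rewrite ImM /=; ring.
Qed.

Definition ccont f := continuous (fun x => Re (f x)) /\ continuous (fun x => Im (f x)).

Lemma cder_ccont f (d : R -> C) : (forall x, is_derive_cplx f x (d x)) -> ccont f.
Proof.
move=> fd; split; apply: der_cont => x; have [fr fi] := fd x.
  by exists (Re (d x)).
by exists (Im (d x)).
Qed.

Lemma ccont_ext f g : (forall y, f y = g y) -> ccont f -> ccont g.
Proof. by move=> /funext ->. Qed.

Lemma ccont_cst z : ccont (fun=> z).
Proof. by split=> x; exact: cst_continuous. Qed.

Lemma ccont_add f g : ccont f -> ccont g -> ccont (fun y => f y + g y).
Proof.
move=> [fr fi] [gr gi]; split=> x.
  under eq_fun do rewrite ReD; by apply: cvgD; [exact: fr|exact: gr].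
under eq_fun do rewrite ImD; by apply: cvgD; [exact: fi|exact: gi].
Qed.

Lemma ccont_mul f g : ccont f -> ccont g -> ccont (fun y => f y * g y).
Proof.
move=> [fr fi] [gr gi]; split=> x.
  under eq_fun do rewrite ReM.
  by apply: cvgB; apply: cvgM; [exact: fr|exact: gr|exact: fi|exact: gi].
under eq_fun do rewrite ImM.
by apply: cvgD; apply: cvgM; [exact: fr|exact: gi|exact: fi|exact: gr].
Qed.

Lemma ccont_sum (I : Type) (r : seq I) (F : I -> R -> C) :
  (forall i, ccont (F i)) -> ccont (fun y => \sum_(i <- r) F i y).
Proof.
move=> dFi; elim: r => [|i r IH].
  apply: ccont_ext (ccont_cst 0) => y; by rewrite big_nil.
apply: ccont_ext (ccont_add (dFi i) IH) => y.
by rewrite big_cons.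
Qed.

Lemma ccont_opp f : ccont f -> ccont (fun y => - f y).
Proof.
move=> /(ccont_mul (ccont_cst (-1))); apply: ccont_ext => y.
by rewrite mulN1r.
Qed.

Lemma ccont_conj f : ccont f -> ccont (fun y => (f y)^*).
Proof.
move=> [fr fi]; split=> x.
  under eq_fun do rewrite ReJ; exact: fr.
under eq_fun do rewrite ImJ; apply: cvgN; exact: fi.
Qed.

Lemma ccont_reflect f : ccont f -> ccont (fun y => f (- y)).
Proof.
move=> [fr fi]; split=> x.
  apply: (@continuous_comp _ _ _ -%R (fun y => Re (f y))); [exact: opp_continuous|exact: fr].
apply: (@continuous_comp _ _ _ -%R (fun y => Im (f y))); [exact: opp_continuous|exact: fi].
Qed.

Lemma ccont_normc f : ccont f -> continuous (fun y => nc (f y)).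
Proof.
move=> [fr fi] x.
have -> : (fun y => nc (f y)) = (fun y => Num.sqrt (Re (f y) ^+ 2 + Im (f y) ^+ 2)).
  by apply/funext => y; case: (f y).
apply: continuous_comp; last exact: sqrt_continuous.
by apply: cvgD; rewrite /= expr2; under eq_fun do rewrite expr2; apply: cvgM; [exact: fr|exact: fr|exact: fi|exact: fi].
Qed.

Definition cvanishing f := vanishing (fun y => nc (f y)).

Lemma cvanishing_le f g : (exists A, forall y, y <= A -> nc (g y) <= nc (f y)) ->
  cvanishing f -> cvanishing g.
Proof.
move=> [A hA] fv e e0; have [B hB] := fv e e0.
exists (Num.min A B) => y; rewrite le_min => /andP[yA yB].
rewrite ger0_norm ?normc_ge0// (le_trans (hA y yA))//.
by have := hB y yB; rewrite ger0_norm// normc_ge0.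
Qed.

Lemma cvanishing_add f g : cvanishing f -> cvanishing g -> cvanishing (fun y => f y + g y).
Proof.
move=> fv gv e e0; have e2 : 0 < e / 2 by rewrite divr_gt0.
have [A hA] := fv _ e2; have [B hB] := gv _ e2.
exists (Num.min A B) => y; rewrite le_min => /andP[yA yB].
have := hA y yA; have := hB y yB; rewrite !ger0_norm ?normc_ge0// => h1 h2.
by apply: le_trans (le_normcD _ _) _; lra.
Qed.

Lemma cvanishing_scale z f : cvanishing f -> cvanishing (fun y => z * f y).
Proof.
move=> fv e e0; have n0 := normc_ge0 z.
have e2 : 0 < e / (nc z + 1) by rewrite divr_gt0// ltr_wpDl.
have [A hA] := fv _ e2; exists A => y yA.
have := hA y yA; rewrite !ger0_norm ?normc_ge0// Normc.normcM.
rewrite ler_pdivlMr ?ltr_wpDl// => h; have := normc_ge0 (f y); lra.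
Qed.

Lemma cvanishing_sub f g : cvanishing f -> cvanishing g -> cvanishing (fun y => f y - g y).
Proof.
move=> fv gv; apply: cvanishing_add => //.
have := cvanishing_scale (-1) gv; congr cvanishing; apply/funext => y.
by rewrite mulN1r.
Qed.

End ComplexCalculus.

(** * Linear systems dominated by an integrable density *)

Section Estimates.
Context {R : realType}.
Local Notation C := R[i].
Local Notation Re := complex.Re.
Local Notation Im := complex.Im.
Local Notation nc := Normc.normc.
Implicit Types (f g h : R -> C) (x y : R) (z kappa : C).

(** The counterpart of comparing the integrals of [u'] and [w'] from [-oo]: [w - u] is nondecreasing
    up to [x], and at least [- e] far to the left. *)
Lemma vanishing_le_dominated (u u' w w' : R -> R) x : vanishing u ->
  (forall y, is_derive y 1 u (u' y)) -> (forall y, is_derive y 1 w (w' y)) ->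
  (forall y, 0 <= w y) -> (forall y, y <= x -> u' y <= w' y) -> u x <= w x.
Proof.
move=> uv du dw w0 uw; apply/ler_addgt0Pr => e e0.
have [A hA] := uv e e0; pose y := Num.min A x.
have yA : y <= A by rewrite ge_min lexx.
have yx : y <= x by rewrite ge_min lexx orbT.
have : w y - u y <= w x - u x.
  pose D t := w t - u t; rewrite -/(D y) -/(D x).
  apply: (@der_ndecr R D (fun t => w' t - u' t)) => // t /andP[_ tx].
  by rewrite subr_ge0 uw.
by have := hA y yA; rewrite ler_norml => /andP[_]; have := w0 y; lra.
Qed.

(** The bound on [g] is the derivative of [expR (b * y) * v y]. A modulus is not differentiable at
    its zeros, so the real and imaginary parts are compared separately, which costs the factor 2. *)
Lemma cvanishing_le_dominated (G g : R -> C) (v v' : R -> R) (b x : R) :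
  cvanishing G -> (forall y, is_derive_cplx G y (g y)) ->
  (forall y, is_derive y 1 v (v' y)) -> (forall y, 0 <= v y) ->
  (forall y, y <= x -> nc (g y) <= expR (b * y) * (v' y + b * v y)) ->
  nc (G x) <= 2 * (expR (b * x) * v x).
Proof.
move=> Gv dG dv v0 gv.
pose w y := expR (b * y) * v y.
have dby y : is_derive y 1 (fun y => b * y) b by exact: der_linear.
have dw y : is_derive y 1 w (expR (b * y) * (v' y + b * v y)).
  by apply: is_derive_eq (der_mul (der_expR (dby y)) (dv y)) _; ring.
have w0 y : 0 <= w y by rewrite mulr_ge0 ?expR_ge0.
have part (u u' : R -> R) : (forall y, is_derive y 1 u (u' y)) ->
    (forall y, `|u y| <= nc (G y)) -> (forall y, `|u' y| <= nc (g y)) -> `|u x| <= w x.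
  move=> du uG ug.
  have uv : vanishing u.
    move=> e e0; have [A hA] := Gv e e0; exists A => y /hA.
    by rewrite ger0_norm ?normc_ge0//; apply: le_trans.
  have bnd y : y <= x -> `|u' y| <= expR (b * y) * (v' y + b * v y).
    by move=> yx; apply: le_trans (ug y) (gv y yx).
  rewrite ler_norml; apply/andP; split.
    rewrite lerNl; apply: (vanishing_le_dominated (u := fun y => - u y)
      (u' := fun y => - u' y) _ _ dw w0) => [|y /bnd].
    - by move=> e /uv[A hA]; exists A => y /hA; rewrite normrN.
    - by rewrite ler_norml; lra.
  apply: (vanishing_le_dominated uv du dw w0) => y /bnd.
  by rewrite ler_norml; lra.
apply: le_trans (normc_le_ReIm _) _.
have := part (fun y => Re (G y)) (fun y => Re (g y)) (fun y => (dG y).1)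
  (fun y => normr_Re_le _) (fun y => normr_Re_le _).
have := part (fun y => Im (G y)) (fun y => Im (g y)) (fun y => (dG y).2)
  (fun y => normr_Im_le _) (fun y => normr_Im_le _).
rewrite /w; lra.
Qed.

(** The factor [cexp (- kappa * y%:C)] removes the diagonal term, and [v] is a supersolution of the
    equation with rate [Re kappa] and source [nc (f y)]. Since [Re kappa <= 0], the factor has
    modulus at most 1 for [y <= 0], so the product still vanishes at [-oo]. *)
Lemma scalar_bound kappa (h f : R -> C) (v v' : R -> R) (x : R) :
  Re kappa <= 0 -> cvanishing h ->
  (forall y, is_derive_cplx h y (kappa * h y + f y)) ->
  (forall y, is_derive y 1 v (v' y)) -> (forall y, 0 <= v y) ->
  (forall y, y <= x -> nc (f y) <= v' y - Re kappa * v y) ->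
  nc (h x) <= 2 * v x.
Proof.
move=> k0 hv dh dv v0 fv.
pose G y := cexp (- kappa * y%:C) * h y.
have nE y : nc (cexp (- kappa * y%:C)) = expR (- Re kappa * y).
  by rewrite normc_cexp !ReImE /= mulr0 subr0.
have dG y : is_derive_cplx G y (cexp (- kappa * y%:C) * f y).
  by apply: cder_eq (cder_mul (cder_cexp (- kappa) y) (dh y)) _; ring.
have Gv : cvanishing G.
  apply: cvanishing_le hv; exists 0 => y y0.
  rewrite Normc.normcM nE -[leRHS]mul1r ler_wpM2r ?normc_ge0//.
  by rewrite -expR0 ler_expR mulr_ge0_le0// oppr_ge0.
have := cvanishing_le_dominated (b := - Re kappa) (x := x) Gv dG dv v0.
rewrite Normc.normcM nE => H.
have e0 : 0 < expR (- Re kappa * x) by exact: expR_gt0.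
rewrite -(ler_pM2l e0); have -> : expR (- Re kappa * x) * (2 * v x) =
  2 * (expR (- Re kappa * x) * v x) by ring.
apply: H => y yx; rewrite Normc.normcM nE ler_wpM2l ?expR_ge0//.
by have := fv y yx; lra.
Qed.

(** Variation of constants: [h] is [cexp (kappa * x%:C)] times the primitive of [g] that vanishes at
    [-oo]. *)
Lemma scalar_solution m M kappa f (B : R) : density m M -> Re kappa <= 0 ->
  ccont f -> 0 <= B -> (forall x, x <= 0 -> nc (f x) <= B * m x) ->
  exists h, (forall x, is_derive_cplx h x (kappa * h x + f x)) /\ cvanishing h.
Proof.
move=> dm k0 fc B0 fm.
pose g y := cexp (- kappa * y%:C) * f y.
have nE z y : nc (cexp (z * y%:C)) = expR (Re z * y).
  by rewrite normc_cexp !ReImE /= mulr0 subr0.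
have gc : ccont g.
  by apply: ccont_mul fc; apply: cder_ccont => x; exact: cder_cexp.
have gm x : x <= 0 -> nc (g x) <= B * m x.
  move=> x0; rewrite Normc.normcM nE -[leRHS]mul1r ler_pM ?expR_ge0 ?normc_ge0 ?fm//.
  by rewrite -expR0 ler_expR ReN mulr_ge0_le0// oppr_ge0.
have [F1 [dF1 vF1]] : exists F, (forall x, is_derive x 1 F (Re (g x))) /\ vanishing F.
  apply: (vanishing_primitive dm gc.1 B0) => x x0.
  exact: le_trans (normr_Re_le _) (gm x x0).
have [F2 [dF2 vF2]] : exists F, (forall x, is_derive x 1 F (Im (g x))) /\ vanishing F.
  apply: (vanishing_primitive dm gc.2 B0) => x x0.
  exact: le_trans (normr_Im_le _) (gm x x0).
pose G y := F1 y +i* F2 y.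
have dG x : is_derive_cplx G x (g x) by split; [exact: dF1|exact: dF2].
have Gv : cvanishing G.
  move=> e e0; have e2 : 0 < e / 2 by rewrite divr_gt0.
  have [a1 h1] := vF1 _ e2; have [a2 h2] := vF2 _ e2.
  exists (Num.min a1 a2) => y; rewrite le_min => /andP[y1 y2].
  rewrite ger0_norm ?normc_ge0//; apply: le_trans (normc_le_ReIm _) _ => /=.
  by have := h1 y y1; have := h2 y y2; lra.
exists (fun x => cexp (kappa * x%:C) * G x); split => [x|].
  apply: cder_eq (cder_mul (cder_cexp kappa x) (dG x)) _.
  rewrite -mulrA; congr (_ + _); rewrite /g mulrA mulNr cexpN mul1r //.
have M0 := density_prim_ge0 dm.
have [dM mc m0 Mv [Mt hMt]] := dm.
(* For [Re kappa < 0] the exponential blows up at [-oo], so the vanishing of [G] alone is too weak;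
   the weighted bound [Gle] compensates exactly this growth. *)
move=> e e0; have e2 : 0 < e / (2 * B + 1) by rewrite divr_gt0// ltr_wpDl// mulr_ge0.
have [A hA] := Mv _ e2; exists (Num.min A 0) => y; rewrite le_min => /andP[yA y0].
rewrite ger0_norm ?normc_ge0// Normc.normcM nE.
have dBM x : is_derive x 1 (fun y => B * M y) (B * m x).
  exact: (der_scale _ (dM _)).
have Gle : nc (G y) <= 2 * (expR (- Re kappa * y) * (B * M y)).
  apply: (cvanishing_le_dominated Gv dG dBM) => [x|x xy]; first by rewrite mulr_ge0.
  rewrite Normc.normcM nE ReN ler_wpM2l ?expR_ge0//.
  apply: le_trans (fm x (le_trans xy y0)) _; rewrite lerDl mulr_ge0 ?oppr_ge0//.
  by rewrite mulr_ge0.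
have -> : e = expR (Re kappa * y) * (expR (- Re kappa * y) * e).
  by rewrite mulrA -expRD mulNr subrr expR0 mul1r.
rewrite ler_wpM2l ?expR_ge0//; apply: le_trans Gle _.
have -> : 2 * (expR (- Re kappa * y) * (B * M y)) =
   expR (- Re kappa * y) * (2 * B * M y) by ring.
rewrite ler_wpM2l ?expR_ge0//.
have := hA y yA; rewrite ger0_norm// ler_pdivlMr ?ltr_wpDl ?mulr_ge0//.
by have := M0 y; lra.
Qed.

(** The diagonal rates are kept apart from the coupling [A]: only the latter is dominated by a
    density, while the former are controlled by the sign of their real part. *)
Definition solves (kap : 'I_4 -> C) (A : 'I_4 -> 'I_4 -> R -> C)
    (f d : 'I_4 -> R -> C) :=
  forall k x, is_derive_cplx (d k) x
    (kap k * d k x + \sum_(j < 4) A k j x * d j x + f k x).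

Definition energy (d : 'I_4 -> R -> C) x := \sum_(k < 4) nc (d k x) ^+ 2.

Lemma energy_ge0 (d : 'I_4 -> R -> C) x : 0 <= energy d x.
Proof. by apply: sumr_ge0 => k _; exact: sqr_ge0. Qed.

(** Lets a scalar equation be treated as four identical uncoupled components. *)
Lemma energy_const (h : R -> C) x : energy (fun=> h) x = 4 * nc (h x) ^+ 2.
Proof. by rewrite /energy sumr_const card_ord -[LHS]mulr_natl. Qed.

Lemma normc_le_energy (d : 'I_4 -> R -> C) k x : nc (d k x) ^+ 2 <= energy d x.
Proof.
rewrite /energy (bigD1 k)//= lerDl; apply: sumr_ge0 => j _; exact: sqr_ge0.
Qed.

(* The diagonal rates only decrease the energy because [Re (kap k) <= 0], so the
   bound does not depend on them. *)
Lemma energy_estimate kap A (d f : 'I_4 -> R -> C) (m M : R -> R) (e a b : R) :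
  a <= b -> solves kap A f d -> (forall k, Re (kap k) <= 0) ->
  (forall y, a <= y <= b -> is_derive y 1 M (m y)) ->
  (forall k j y, a <= y <= b -> nc (A k j y) <= m y) -> 0 <= e ->
  (forall k y, a <= y <= b -> nc (f k y) <= e * m y) ->
  energy d b + e ^+ 2 <= (energy d a + e ^+ 2) * expR (9 * (M b - M a)).
Proof.
move=> ab sol k0 dM Am e0 fm.
have m0 y : a <= y <= b -> 0 <= m y.
  by move=> yab; apply: le_trans (Am 0 0 y yab); exact: normc_ge0.
pose N' y := \sum_(k < 4) 2 * Re ((d k y)^* *
  (kap k * d k y + \sum_(j < 4) A k j y * d j y + f k y)).
have dN y : is_derive y 1 (energy d) (N' y).
  by apply: der_sum => k; apply: der_normc_sqr; exact: sol.
(* The constant is 9 = 8 + 1. By the inequality between the two means, the sixteen coupling terms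
   contribute [8 * m y * energy d y], and the sources [m y * (energy d y + 4 * e ^+ 2)]. *)
have N'le y : a <= y <= b -> N' y <= 9 * m y * (energy d y + e ^+ 2).
  move=> yab; have my := m0 y yab.
  apply: (@le_trans _ _ (\sum_(k < 4) (m y * (4 * nc (d k y) ^+ 2 + energy d y)
     + m y * (nc (d k y) ^+ 2 + e ^+ 2)))).
    apply: ler_sum => k _.
    have b1 : Re ((d k y)^* * (kap k * d k y)) <= 0.
      have -> : (d k y)^* * (kap k * d k y) = kap k * ((nc (d k y) ^+ 2)%:C).
        rewrite normc_sqr; case: (kap k) (d k y) => p q [r s].
        by apply: complex_eq; rewrite /=; ring.
      by rewrite ReM /= mulr0 subr0 mulr_le0_ge0 ?sqr_ge0.
    have b2 : 2 * Re ((d k y)^* * \sum_(j < 4) A k j y * d j y) <=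
        m y * (4 * nc (d k y) ^+ 2 + energy d y).
      rewrite mulr_sumr Re_sum mulr_sumr.
      apply: (@le_trans _ _ (\sum_(j < 4) m y * (nc (d k y) ^+ 2 + nc (d j y) ^+ 2))).
        apply: ler_sum => j _.
        have h1 := Re_normcM (d k y) (A k j y * d j y).
        rewrite Normc.normcM in h1.
        have h2 : nc (d k y) * (nc (A k j y) * nc (d j y)) <=
            nc (d k y) * (m y * nc (d j y)).
          by rewrite ler_wpM2l ?normc_ge0// ler_wpM2r ?normc_ge0// Am.
        have h3 : m y * (2 * (nc (d k y) * nc (d j y))) <=
            m y * (nc (d k y) ^+ 2 + nc (d j y) ^+ 2).
          rewrite ler_wpM2l// -subr_ge0.
          have -> : nc (d k y) ^+ 2 + nc (d j y) ^+ 2 - 2 * (nc (d k y) * nc (d j y))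
             = (nc (d k y) - nc (d j y)) ^+ 2 by ring.
          exact: sqr_ge0.
        by apply: le_trans h3; lra.
      rewrite -mulr_sumr big_split /= -/(energy d y) sumr_const card_ord.
      by rewrite -[_ *+ 4]mulr_natl.
    have b3 : 2 * Re ((d k y)^* * f k y) <= m y * (nc (d k y) ^+ 2 + e ^+ 2).
      have h1 := Re_normcM (d k y) (f k y).
      have h2 : nc (d k y) * nc (f k y) <= nc (d k y) * (e * m y).
        by rewrite ler_wpM2l ?normc_ge0// fm.
      have h3 : m y * (2 * (nc (d k y) * e)) <= m y * (nc (d k y) ^+ 2 + e ^+ 2).
        rewrite ler_wpM2l// -subr_ge0.
        have -> : nc (d k y) ^+ 2 + e ^+ 2 - 2 * (nc (d k y) * e)
           = (nc (d k y) - e) ^+ 2 by ring.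
        exact: sqr_ge0.
      by apply: le_trans h3; lra.
    rewrite !mulrDr !ReD; rewrite !mulrDr in b2 b3; lra.
  rewrite big_split /= -!mulr_sumr !big_split /= -!mulr_sumr -/(energy d y).
  rewrite !sumr_const !card_ord -[energy d y *+ _]mulr_natl -[_ *+ 4]mulr_natl.
  have E0 := energy_ge0 d y.
  have : 0 <= m y * e ^+ 2 by rewrite mulr_ge0 ?sqr_ge0.
  by lra.
pose phi y := (energy d y + e ^+ 2) * expR (- 9 * M y).
have dphi y : a <= y <= b -> is_derive y 1 phi
    (expR (- 9 * M y) * (N' y - 9 * m y * (energy d y + e ^+ 2))).
  move=> yab.
  have d9 : is_derive y 1 (fun y => - 9 * M y) (- 9 * m y).
    exact: (der_scale _ (dM y yab)).
  apply: is_derive_eq (der_mul (der_add (dN y) (der_cst y (e ^+ 2))) (der_expR d9)) _.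
  by ring.
have : phi b <= phi a.
  apply: (der_nincr ab dphi) => y yab.
  by rewrite mulr_ge0_le0 ?expR_ge0// subr_le0 N'le.
rewrite /phi => H.
have -> : 9 * (M b - M a) = - 9 * M a + 9 * M b by ring.
rewrite expRD mulrA.
have -> : energy d b + e ^+ 2 = (energy d b + e ^+ 2) * expR (- 9 * M b) * expR (9 * M b).
  by rewrite -mulrA -expRD mulNr addNr expR0 mulr1.
by rewrite ler_wpM2r ?expR_ge0.
Qed.

(** The previous estimate on [[a, x]], with [a] so far to the left that the initial energy is
    arbitrarily small: only the source contributes. *)
Lemma energy_estimate_Ny kap A (d f : 'I_4 -> R -> C) (m M : R -> R) (e x : R) :
  solves kap A f d -> (forall k, Re (kap k) <= 0) -> density m M ->
  (forall k j y, nc (A k j y) <= m y) -> 0 <= e ->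
  (forall k y, y <= x -> nc (f k y) <= e * m y) -> (forall k, cvanishing (d k)) ->
  energy d x + e ^+ 2 <= e ^+ 2 * expR (9 * M x).
Proof.
move=> sol k0 dm Am e0 fm dv.
have [dM mc m0 Mv [Mt hMt]] := dm.
have Ev : vanishing (energy d).
  move=> t t0; have s0 : 0 < Num.sqrt (t / 4) by rewrite sqrtr_gt0 divr_gt0.
  have [B hB] : exists B, forall k y, y <= B -> nc (d k y) <= Num.sqrt (t / 4).
    have /choice[B hB] : forall k, exists B, forall y, y <= B -> nc (d k y) <= Num.sqrt (t / 4).
      move=> k; have [B hB] := dv k _ s0; exists B => y /hB.
      by rewrite ger0_norm ?normc_ge0.
    exists (\big[Num.min/0]_(k < 4) B k) => k y yB; apply: hB; apply: le_trans yB _.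
    exact: bigmin_le_cond.
  exists B => y yB; rewrite ger0_norm ?energy_ge0//.
  have -> : t = \sum_(k < 4) t / 4.
    by rewrite sumr_const card_ord -mulr_natl; field.
  apply: ler_sum => k _; rewrite -(sqr_sqrtr (divr_ge0 (ltW t0) (ler0n R 4))).
  by rewrite ler_pXn2r ?nnegrE ?normc_ge0 ?sqrtr_ge0 ?hB.
apply/ler_addgt0Pr => t t0.
have E0 : 0 < expR (9 * M x) by exact: expR_gt0.
have [B hB] := Ev _ (divr_gt0 t0 E0).
pose a := Num.min B x.
have aB : a <= B by rewrite ge_min lexx.
have ax : a <= x by rewrite ge_min lexx orbT.
have := @energy_estimate kap A d f m M e a x ax sol k0 (fun y _ => dM y)
  (fun k j y _ => Am k j y) e0 _.
have := hB a aB; rewrite ger0_norm ?energy_ge0// ler_pdivlMr// => h1 h2.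
have h3 : expR (9 * (M x - M a)) <= expR (9 * M x).
  by rewrite ler_expR ler_wpM2l// gerBl (density_prim_ge0 dm).
have {}h2 : energy d x + e ^+ 2 <= (energy d a + e ^+ 2) * expR (9 * M x).
  apply: le_trans (h2 _) _ => [k y /andP[_ yx]|]; first exact: fm.
  by rewrite ler_wpM2l// addr_ge0 ?energy_ge0 ?sqr_ge0.
have := sqr_ge0 e; lra.
Qed.

End Estimates.

(** * Existence by Picard iteration, and convolution of a density with a decaying exponential *)

Section Existence.
Context {R : realType}.
Local Notation C := R[i].
Local Notation Re := complex.Re.
Local Notation Im := complex.Im.
Local Notation nc := Normc.normc.
Implicit Types (x y : R) (z kappa : C).

Lemma density_add m1 M1 m2 M2 : @density R m1 M1 -> density m2 M2 ->
  density (fun y => m1 y + m2 y) (fun y => M1 y + M2 y).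
Proof.
move=> [d1 c1 p1 v1 [B1 b1]] [d2 c2 p2 v2 [B2 b2]]; split.
- by move=> x; apply: der_add.
- by move=> x; apply: cvgD; [exact: c1|exact: c2].
- by move=> x; rewrite addr_ge0.
- move=> e e0; have e2 : 0 < e / 2 by rewrite divr_gt0.
  have [a1 h1] := v1 _ e2; have [a2 h2] := v2 _ e2.
  exists (Num.min a1 a2) => y; rewrite le_min => /andP[y1 y2].
  apply: le_trans (ler_normD _ _) _.
  by have := h1 y y1; have := h2 y y2; lra.
- by exists (B1 + B2) => x; rewrite lerD.
Qed.

Lemma halving_small (K e : R) : 0 < e -> exists n : nat, K / 2 ^+ n <= e.
Proof.
move=> e0; exists (Num.bound `|K / e|); rewrite ler_pdivrMr ?exprn_gt0//.
have h : `|K / e| < (Num.bound `|K / e|)%:R by apply: archi_boundP; exact: normr_ge0.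
have h2 : ((Num.bound `|K / e|)%:R : R) <= 2 ^+ Num.bound `|K / e|.
  by rewrite -natrX ler_nat ltnW// ltn_expl.
rewrite mulrC -ler_pdivrMr//; apply: le_trans h2; apply: le_trans (ltW h).
exact: ler_norm.
Qed.

(** The radius [2 * c / 2 ^+ n] is the whole geometric tail of the increments, so the intervals of
    that radius around [u n] are nested; the supremum of their left ends lies in all of them. *)
Lemma halving_limit (u : nat -> R) (c : R) :
  (forall n, `|u n.+1 - u n| <= c / 2 ^+ n) ->
  exists l, forall n, `|l - u n| <= 2 * c / 2 ^+ n.
Proof.
move=> uc; pose a n := u n - 2 * c / 2 ^+ n; pose b n := u n + 2 * c / 2 ^+ n.
have half n : c / 2 ^+ n.+1 = (c / 2 ^+ n) / 2 by rewrite exprS invfM; ring.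
have c0 n : 0 <= c / 2 ^+ n by apply: le_trans (uc n).
have aS n : a n <= a n.+1.
  by rewrite /a -!mulrA half; have := uc n; rewrite ler_norml => /andP[]; lra.
have bS n : b n.+1 <= b n.
  by rewrite /b -!mulrA half; have := uc n; rewrite ler_norml => /andP[]; lra.
have amono n m : (n <= m)%N -> a n <= a m.
  move=> /subnK <-; elim: (m - n)%N => [|k IH]; first by rewrite add0n.
  by apply: le_trans IH _; rewrite addSn.
have bmono n m : (n <= m)%N -> b m <= b n.
  move=> /subnK <-; elim: (m - n)%N => [|k IH]; first by rewrite add0n.
  by apply: le_trans IH; rewrite addSn.
have ab n m : a n <= b m.
  apply: le_trans (amono n (maxn n m) (leq_maxl _ _)) _.
  apply: le_trans (bmono m (maxn n m) (leq_maxr _ _)).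
  by rewrite /a /b -!mulrA; have := c0 (maxn n m); lra.
exists (sup (range a)) => n.
have h1 : a n <= sup (range a).
  apply: ub_le_sup; last by exists n.
  by exists (b 0%N) => _ [m _ <-].
have h2 : sup (range a) <= b n.
  apply: ge_sup; first by exists (a 0%N), 0%N.
  by move=> _ [m _ <-].
by rewrite ler_norml; rewrite /a in h1; rewrite /b in h2; apply/andP; split; lra.
Qed.

(** The convergence is uniform only where [W] is bounded; near [x] the bound [W x + 1] serves. *)
Lemma halving_continuous (g : R -> R) (u : nat -> R -> R) (W : R -> R) :
  (forall n, continuous (u n)) -> continuous W -> (forall x, 0 <= W x) ->
  (forall n x, `|g x - u n x| <= W x / 2 ^+ n) -> continuous g.
Proof.
move=> uc Wc W0 gu x; apply/cvgrPdist_le => e e0.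
have e3 : 0 < e / 3 by rewrite divr_gt0.
have [n hn] := halving_small (W x + 1) e3.
have p2 : 0 < (2 ^+ n : R)^-1 by rewrite invr_gt0 exprn_gt0.
have /cvgrPdist_le/(_ _ ltr01) hW := Wc x.
have /cvgrPdist_le/(_ _ e3) hu := uc n x.
near=> y.
have h1 : `|u n x - u n y| <= e / 3 by near: y.
have h2 : `|W x - W y| <= 1 by near: y.
have h3 : `|g y - u n y| <= e / 3.
  apply: le_trans (gu n y) _; apply: le_trans hn; rewrite ler_pM2r//.
  by rewrite ler_norml in h2; lra.
have h4 : `|g x - u n x| <= e / 3.
  apply: le_trans (gu n x) _; apply: le_trans hn; rewrite ler_pM2r//; lra.
rewrite !ler_norml in h1 h3 h4 *; lra.
Unshelve. all: by end_near. Qed.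

(* Picard iteration: with the weight [exp (16 M)] the Volterra operator halves
   distances, whatever the rates. *)
Lemma system_solution kap A (f : 'I_4 -> R -> C) m M (B : R) :
  density m M -> (forall k, Re (kap k) <= 0) ->
  (forall k j, ccont (A k j)) -> (forall k j y, nc (A k j y) <= m y) ->
  (forall k, ccont (f k)) -> 0 <= B -> (forall k y, nc (f k y) <= B * m y) ->
  exists d, solves kap A f d /\ (forall k, cvanishing (d k)).
Proof.
move=> dm k0 Ac Am fc B0 fm.
have [dM mc m0 Mv [Mt hMt]] := dm; have M0 := density_prim_ge0 dm.
(* A difference of size [c * W] yields a source of size [4 * c * m * W] (four entries), whose
   primitive is [4 * c / 16 * W]; the factor 2 of [scalar_bound] brings this to [c / 2 * W]. *)
pose W y := expR (16 * M y).
have W0 y : 0 < W y by exact: expR_gt0.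
have W1 y : 1 <= W y by rewrite -expR0 ler_expR mulr_ge0.
have dW y : is_derive y 1 W (16 * m y * W y).
  have d16 : is_derive y 1 (fun y => 16 * M y) (16 * m y).
    exact: (der_scale _ (dM _)).
  by apply: is_derive_eq (der_expR d16) _; rewrite mulrC.
have Wc : continuous W by apply: der_cont => x; exists (16 * m x * W x).
have dcW c y : is_derive y 1 (fun y => c / 16 * W y) (c * m y * W y).
  by apply: is_derive_eq (der_scale (c / 16) (dW y)) _; field.
have sumA (g : 'I_4 -> R -> C) c k y : (forall j, nc (g j y) <= c * W y) ->
    nc (\sum_(j < 4) A k j y * g j y) <= 4 * c * m y * W y.
  move=> gc; apply: le_trans (normc_sum _ _) _.
  have -> : 4 * c * m y * W y = \sum_(j < 4) m y * (c * W y).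
    by rewrite sumr_const card_ord -mulr_natl; ring.
  apply: ler_sum => j _; rewrite Normc.normcM.
  by rewrite ler_pM ?normc_ge0.
pose good (g : 'I_4 -> R -> C) := (forall k, ccont (g k)) /\
  exists2 c, 0 <= c & forall k y, nc (g k y) <= c * W y.
pose image (g h : 'I_4 -> R -> C) := (forall k x, is_derive_cplx (h k) x
   (kap k * h k x + (\sum_(j < 4) A k j x * g j x + f k x))) /\ forall k, cvanishing (h k).
have source (g : 'I_4 -> R -> C) c k y : (forall j y, nc (g j y) <= c * W y) -> 0 <= c ->
    nc (\sum_(j < 4) A k j y * g j y + f k y) <= (4 * c + B) * m y * W y.
  move=> gc c0; apply: le_trans (le_normcD _ _) _.
  have := sumA g c k y (fun j => gc j y); have := fm k y.
  have : B * m y * 1 <= B * m y * W y by rewrite ler_wpM2l ?mulr_ge0.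
  by lra.
(* [T g] is the image of [g] under the Volterra operator; outside [good] its value is a dummy. *)
have /choice[T hT] : forall g : 'I_4 -> R -> C, exists h, good g -> image g h.
  move=> g; have [gg|ng] := pselect (good g); last by exists g.
  have [gc [c c0 gb]] := gg.
  have /choice[h hh] : forall k, exists h, (forall x, is_derive_cplx h x
      (kap k * h x + (\sum_(j < 4) A k j x * g j x + f k x))) /\ cvanishing h.
    (* Only the negative axis matters for the domination, and there the weight is at most [W 0]. *)
    move=> k; apply: (@scalar_solution R m M (kap k) _ ((4 * c + B) * W 0)) => //.
    - apply: ccont_add => //; apply: ccont_sum => j; exact: ccont_mul.
    - by rewrite mulr_ge0 ?addr_ge0 ?mulr_ge0// ltW.
    - move=> x x0; apply: le_trans (source g c k x gb c0) _.
      rewrite mulrAC ler_wpM2r// ler_wpM2l ?addr_ge0 ?mulr_ge0//.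
      by rewrite ler_expR ler_wpM2l// (density_le dm).
  by exists h => _; split => [k x|k]; have [] := hh k.
have goodT (g : 'I_4 -> R -> C) : good g -> good (T g).
  move=> gg; have [dT vT] := hT g gg; have [gc [c c0 gb]] := gg; split.
    move=> k; exact: cder_ccont (dT k).
  exists (2 * ((4 * c + B) / 16)); first by rewrite mulr_ge0// divr_ge0 ?addr_ge0 ?mulr_ge0.
  move=> k x; rewrite -mulrA.
  apply: (scalar_bound (k0 k) (vT k) (dT k) (dcW (4 * c + B))) => y.
    by rewrite mulr_ge0 ?divr_ge0 ?addr_ge0 ?mulr_ge0// ltW.
  move=> yx; apply: le_trans (source g c k y gb c0) _.
  rewrite lerDl oppr_ge0 mulr_le0_ge0// mulr_ge0 ?divr_ge0 ?addr_ge0 ?mulr_ge0//.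
  exact: ltW.
have contr (g h : 'I_4 -> R -> C) c : 0 <= c -> good g -> good h ->
    (forall k y, nc (g k y - h k y) <= c * W y) ->
    forall k y, nc (T g k y - T h k y) <= c / 2 * W y.
  move=> c0 gg gh gc k x.
  have [dg vg] := hT g gg; have [dh vh] := hT h gh.
  have -> : c / 2 * W x = 2 * (4 * c / 16 * W x) by field.
  apply: (@scalar_bound _ (kap k) (fun x => T g k x - T h k x)
     (fun x => \sum_(j < 4) A k j x * (g j x - h j x)) _ _ _ _ _ _ (dcW (4 * c))) => //.
  - exact: cvanishing_sub.
  - move=> y; apply: cder_eq (cder_sub (dg k y) (dh k y)) _.
    under [X in _ = _ + X]eq_bigr do rewrite mulrBr.
    by rewrite big_split /= sumrN; ring.
  - by move=> y; rewrite mulr_ge0 ?divr_ge0 ?mulr_ge0// ltW.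
  - move=> y yx; apply: le_trans (sumA (fun j y => g j y - h j y) c k y (fun j => gc j y)) _.
    rewrite lerDl oppr_ge0 mulr_le0_ge0// mulr_ge0 ?divr_ge0 ?mulr_ge0//.
    exact: ltW.
pose phi n := iter n T (fun _ _ => 0).
have gphi n : good (phi n).
  elim: n => [|n IH]; last exact: goodT.
  split=> [k|]; first exact: ccont_cst.
  by exists 0 => // k y; rewrite Normc.normc0 mul0r.
have [_ [c c0 hc]] := gphi 1%N.
have dphi n k y : nc (phi n.+1 k y - phi n k y) <= c / 2 ^+ n * W y.
  elim: n k y => [|n IH] k y.
    by rewrite expr0 divr1 /phi /= subr0; exact: hc.
  have -> : c / 2 ^+ n.+1 = c / 2 ^+ n / 2 by rewrite exprS invfM; ring.
  apply: (contr (phi n.+1) (phi n)) => //.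
  by rewrite divr_ge0// exprn_ge0.
have lim (p : C -> R) k y : (forall z w, p (z - w) = p z - p w) ->
    (forall z, `|p z| <= nc z) ->
    exists l, forall n, `|l - p (phi n k y)| <= 2 * (c * W y) / 2 ^+ n.
  move=> pB pn; apply: halving_limit => n; rewrite -pB.
  by apply: le_trans (pn _) _; apply: le_trans (dphi n k y) _; rewrite mulrAC.
have ReB z w : Re (z - w) = Re z - Re w by rewrite ReD ReN.
have ImB z w : Im (z - w) = Im z - Im w by rewrite ImD ImN.
have /choice[a ha] : forall ky : 'I_4 * R, exists l, forall n,
    `|l - Re (phi n ky.1 ky.2)| <= 2 * (c * W ky.2) / 2 ^+ n.
  by move=> [k y]; apply: lim => //; exact: normr_Re_le.
have /choice[b hb] : forall ky : 'I_4 * R, exists l, forall n,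
    `|l - Im (phi n ky.1 ky.2)| <= 2 * (c * W ky.2) / 2 ^+ n.
  by move=> [k y]; apply: lim => //; exact: normr_Im_le.
pose d k y : C := a (k, y) +i* b (k, y).
have dlim n k y : nc (d k y - phi n k y) <= 4 * c / 2 ^+ n * W y.
  apply: le_trans (normc_le_ReIm _) _; rewrite ReB ImB.
  have := ha (k, y) n; have := hb (k, y) n => /= h1 h2.
  have -> : 4 * c / 2 ^+ n * W y = 2 * (c * W y) / 2 ^+ n + 2 * (c * W y) / 2 ^+ n by ring.
  exact: lerD.
have gd : good d.
  have cW : continuous (fun y => 2 * (c * W y)).
    move=> x; apply: cvgM; first exact: cvg_cst.
    by apply: cvgM; [exact: cvg_cst|exact: Wc].
  split.
    move=> k; split.
    - apply: (@halving_continuous _ (fun n y => Re (phi n k y)) (fun y => 2 * (c * W y))) => //.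
      + by move=> n; exact: ((gphi n).1 k).1.
      + by move=> x; rewrite !mulr_ge0// ltW.
      + by move=> n x; exact: (ha (k, x) n).
    - apply: (@halving_continuous _ (fun n y => Im (phi n k y)) (fun y => 2 * (c * W y))) => //.
      + by move=> n; exact: ((gphi n).1 k).2.
      + by move=> x; rewrite !mulr_ge0// ltW.
      + by move=> n x; exact: (hb (k, x) n).
  exists (4 * c); first by rewrite mulr_ge0.
  move=> k y; have e0 : d k y - phi 0%N k y = d k y by exact: subr0.
  by have := dlim 0%N k y; rewrite e0 expr0 divr1.
(* Both sides are close to [phi n.+1 = T (phi n)]: [T d] by contraction, [d] as the limit of the
   iterates. *)
have fixd k y : T d k y = d k y.
  apply/eqP; rewrite -subr_eq0; apply/eqP/normc_eq0/ler_addgt0Pr => e e0; rewrite add0r.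
  have [n hn] := halving_small (4 * c * W y) e0.
  have h1 := @contr d (phi n) (4 * c / 2 ^+ n) _ gd (gphi n) (dlim n) k y.
  have h2 := dlim n.+1 k y.
  have half : 4 * c / 2 ^+ n.+1 = 4 * c / 2 ^+ n / 2 by rewrite exprS invfM; ring.
  have -> : T d k y - d k y = (T d k y - T (phi n) k y) + - (d k y - phi n.+1 k y).
    by rewrite /phi /=; ring.
  apply: le_trans (le_normcD _ _) _; rewrite normcN.
  apply: le_trans hn; rewrite half in h2.
  have -> : 4 * c * W y / 2 ^+ n = 4 * c / 2 ^+ n / 2 * W y + 4 * c / 2 ^+ n / 2 * W y by field.
  by apply: lerD => //; apply: h1; rewrite divr_ge0 ?mulr_ge0 ?exprn_ge0.
have Td : T d = d by apply/funext => k; apply/funext => y; exact: fixd.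
have [dT vT] := hT d gd; rewrite Td in dT vT.
by exists d; split => // k x; rewrite -addrA.
Qed.

(* The convolution of [m] with [exp (- b t)] is again integrable; its primitive
   is read off the equation [p0' = - b p0 + B m]. *)
Lemma damped_density m M (b B : R) : density m M -> 0 < b -> 0 <= B ->
  exists p P, @density R p P /\
    forall kappa h f, Re kappa = - b -> cvanishing h ->
      (forall y, is_derive_cplx h y (kappa * h y + f y)) ->
      (forall y, nc (f y) <= B * m y) -> forall y, nc (h y) <= p y.
Proof.
move=> dm b0 B0; have [dM mc m0 Mv [Mt hMt]] := dm.
have [h [dh vh]] : exists h : R -> C, (forall x, is_derive_cplx h x
    ((- b)%:C * h x + (B * m x)%:C)) /\ cvanishing h.
  apply: (scalar_solution dm _ _ B0).
  - by rewrite /= oppr_le0 ltW.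
  - split=> x; last exact: cst_continuous.
    by apply: cvgM; [exact: cvg_cst|exact: mc].
  - by move=> x _; rewrite normc_real ger0_norm ?mulr_ge0.
pose p0 y := Re (h y).
have dp0 y : is_derive y 1 p0 (- b * p0 y + B * m y).
  by apply: is_derive_eq (dh y).1 _; rewrite !ReImE /= mul0r subr0.
have p0v : vanishing p0.
  move=> e /vh[A hA]; exists A => y /hA; rewrite ger0_norm ?normc_ge0//.
  exact: le_trans (normr_Re_le _).
have dby y : is_derive y 1 (fun y => b * y) b by exact: der_linear.
(* [expR (b * y) * p0 y] vanishes at [-oo] and has the nonnegative derivative
   [expR (b * y) * (B * m y)]. *)
have p00 x : 0 <= p0 x.
  have : - (expR (b * x) * p0 x) <= 0.
    apply: (@vanishing_le_dominated R (fun y => - (expR (b * y) * p0 y))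
      (fun y => - (expR (b * y) * (B * m y))) (fun=> 0) (fun=> 0)) => //.
    - move=> e /p0v[A hA]; exists (Num.min A 0) => y; rewrite le_min => /andP[/hA yA y0].
      rewrite normrN normrM (ger0_norm (expR_ge0 _)); apply: le_trans yA.
      rewrite -[leRHS]mul1r ler_wpM2r// -expR0 ler_expR mulr_ge0_le0//.
      exact: ltW.
    - move=> y; apply: is_derive_eq (der_opp (der_mul (der_expR (dby y)) (dp0 y))) _.
      by ring.
    - by move=> y _; rewrite oppr_le0 mulr_ge0 ?expR_ge0 ?mulr_ge0.
  by rewrite oppr_le0 pmulr_rge0 ?expR_gt0.
(* The 2 is that of [scalar_bound], applied with [p0] itself as supersolution:
   [p0' + b * p0 = B * m]. *)
exists (fun y => 2 * p0 y), (fun y => 2 / b * (B * M y - p0 y)); split; first split.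
- move=> x; have h1 := der_mul (der_cst x B) (dM x).
  apply: is_derive_eq (der_mul (der_cst x (2 / b)) (der_sub h1 (dp0 x))) _.
  by field; rewrite gt_eqF.
- move=> x; apply: cvgM; first exact: cvg_cst.
  by apply: der_cont => y; exists (- b * p0 y + B * m y).
- by move=> x; rewrite mulr_ge0.
- move=> e e0.
  have e1 : 0 < e * b / (4 * (B + 1)) by rewrite divr_gt0 ?mulr_gt0// ltr_wpDl.
  have e2 : 0 < e * b / 4 by rewrite divr_gt0 ?mulr_gt0.
  have [a1 h1] := Mv _ e1; have [a2 h2] := p0v _ e2.
  exists (Num.min a1 a2) => y; rewrite le_min => /andP[/h1 y1 /h2 y2].
  rewrite normrM gtr0_norm ?divr_gt0// mulrAC ler_pdivrMr//.
  have M0 := density_prim_ge0 dm y; rewrite ger0_norm// in y1.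
  rewrite ger0_norm// in y2.
  rewrite ler_pdivlMr ?mulr_gt0 ?ltr_wpDl// in y1.
  have h3 : 0 <= B * M y by rewrite mulr_ge0.
  have h4 : `|B * M y - p0 y| <= B * M y + p0 y.
    by have := p00 y; rewrite ler_norml => *; apply/andP; split; lra.
  lra.
- exists (2 / b * (B * Mt)) => x; rewrite ler_pM2l ?divr_gt0//.
  by have := p00 x; have : B * M x <= B * Mt by [rewrite ler_wpM2l]; lra.
move=> kappa g f kb gv dg fm x.
apply: (@scalar_bound _ kappa g f p0 _ x _ gv dg dp0 p00); first by rewrite kb oppr_le0 ltW.
by move=> y yx; rewrite kb; have := fm y; lra.
Qed.

End Existence.

(** * A Riemann-Lebesgue lemma in the half-plane *)

Section RiemannLebesgue.
Context {R : realType}.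
Local Notation C := R[i].
Local Notation Re := complex.Re.
Local Notation Im := complex.Im.
Local Notation nc := Normc.normc.
Implicit Types (x y : R) (z kappa : C).

(** Only [s] is confined to the segment: the averages taken below look beyond its right end. *)
Lemma uniform_continuity_segment (u : R -> R) (a b e : R) :
  continuous u -> 0 < e ->
  exists2 d, 0 < d & forall s t, a <= s <= b -> `|s - t| <= d -> `|u s - u t| <= e.
Proof.
move=> uc e0; have e2 : 0 < e / 2 by rewrite divr_gt0.
have := (compact_near_coveringP _).1 (@segment_compact R a b).
move=> /(_ R (0^'+) (fun d s => forall t, `|s - t| <= d -> `|u s - u t| <= e) _).
case.
  move=> x _; have /cvgrPdist_le/(_ _ e2) := uc x.
  rewrite -filter_from_ballE => -[r /= r0 hr].
  have r2 : 0 < r / 2 by rewrite divr_gt0.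
  exists (ball x (r / 2), [set d | d < r / 2]); first split => /=.
  - exact: nbhsx_ballx.
  - exact: nbhs_right_lt.
  move=> [s d] /= [xs dr] t st.
  have h1 : `|u x - u s| <= e / 2.
    apply: hr; apply: le_ball xs; lra.
  have h2 : `|u x - u t| <= e / 2.
    apply: hr; rewrite /ball /= in xs *; rewrite /ball_ in xs *.
    rewrite !ltr_norml in xs *; rewrite ler_norml in st; lra.
  rewrite !ler_norml in h1 h2 *; lra.
move=> d /= d0 hd; exists (d / 2); first by rewrite divr_gt0.
move=> s t sab st; apply: (hd (d / 2)) => //=.
- rewrite /ball_ /= sub0r normrN gtr0_norm ?divr_gt0//; lra.
- by rewrite divr_gt0.
Qed.

Lemma continuous_bounded_segment (u : R -> R) (a b : R) : a <= b -> continuous u ->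
  exists2 K, 0 <= K & forall y, a <= y <= b -> `|u y| <= K.
Proof.
move=> ab uc; have [c _ hc] := @EVT_max R (fun y => `|u y|) a b ab
  (continuous_subspaceT (fun y => continuous_comp (uc y) (@norm_continuous _ _ _))).
exists `|u c| => // y yab; apply: hc; by rewrite in_itv.
Qed.

(** The approximant is the average of [u] over [[y, y + d]]. It gains one derivative, and by the
    mean value theorem it equals [u c] for some [c] within [d] of [y]. *)
Lemma C1_approximation (u : R -> R) (a b e : R) : a <= b -> continuous u -> 0 < e ->
  exists v v', (forall y, is_derive y 1 v (v' y)) /\
    exists2 K, 0 <= K & forall y, a <= y <= b ->
      [/\ `|u y - v y| <= e, `|v y| <= K & `|v' y| <= K].
Proof.
move=> ab uc e0; have [U dU] := antiderivative uc.
have [d d0 hd] := @uniform_continuity_segment u a b e uc e0.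
pose v y := (U (y + d) - U y) / d; pose v' y := (u (y + d) - u y) / d.
have dsh y : is_derive y 1 (fun y => y + d) 1.
  by apply: is_derive_eq (der_add (der_id y) (der_cst y d)) _; rewrite addr0.
have dv y : is_derive y 1 v (v' y).
  apply: is_derive_eq (der_mul (der_sub (der_comp (dsh y) (dU (y + d))) (dU y))
    (der_cst y d^-1)) _.
  by rewrite mulr1 mulr0 addr0.
have vc : continuous v by apply: der_cont => y; exists (v' y).
have v'c : continuous v'.
  move=> y; apply: cvgM; last exact: cvg_cst.
  apply: cvgB; last exact: uc.
  have sc : continuous (fun y => y + d) by apply: der_cont => t; exists 1.
  exact: (continuous_comp (sc y) (uc _)).
have [K1 K10 hK1] := continuous_bounded_segment ab vc.
have [K2 K20 hK2] := continuous_bounded_segment ab v'c.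
exists v, v'; split => //; exists (K1 + K2); first exact: addr_ge0.
move=> y yab; split; last 2 first.
- by apply: le_trans (hK1 y yab) _; rewrite lerDl.
- by apply: le_trans (hK2 y yab) _; rewrite lerDr.
have yd : y <= y + d by rewrite lerDl ltW.
have Uc : {within `[y, y + d], continuous U}.
  by apply: continuous_subspaceT; apply: der_cont => t; exists (u t).
have [c cyd E] := MVT_segment yd (fun t _ => dU t) Uc.
have -> : v y = u c by rewrite /v E; field; rewrite gt_eqF.
apply: hd => //; move: cyd; rewrite in_itv /= ler_norml => /andP[]; lra.
Qed.

(* With [v] a C^1 approximation of [a], the function [h + v / kappa] solves the
   same equation with the small source [a - v + v' / kappa]. *)
Lemma riemann_lebesgue m M (a : R -> C) (B x e : R) : density m M -> ccont a ->
  0 <= B -> (forall y, nc (a y) <= B * m y) -> 0 < e ->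
  exists L, forall kappa h, Re kappa <= 0 -> L < nc kappa ->
    (forall y, is_derive_cplx h y (kappa * h y + a y)) -> cvanishing h ->
    forall y, y <= x -> nc (h y) <= e.
Proof.
move=> dm ac B0 am e0; have [dM mc m0 Mv _] := dm; have M0 := density_prim_ge0 dm.
pose E : R := expR 9.
have E1 : 1 <= E by rewrite -expR0 ler_expR.
have E0 : 0 < E by exact: expR_gt0.
(* [E] bounds the growth factor of the energy over [[A0, x]]. The estimate ends with
   [4 * nc (w y) ^+ 2 <= 5 * (th * E) ^+ 2], and [th * E = e / 4] makes this less than
   [4 * (e / 2) ^+ 2]. *)
pose th := e / (4 * E).
have th0 : 0 < th by rewrite divr_gt0 ?mulr_gt0.
have thE : th * E = e / 4 by rewrite /th; field; rewrite gt_eqF.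
have the : th <= e / 4.
  by rewrite -thE ler_peMr// ltW.
clearbody th.
have B1 : 0 < B + 1 by lra.
have b1 : 0 < th / (4 * (B + 1)) by rewrite divr_gt0// mulr_gt0.
have [A0' hA0] := Mv _ b1.
pose A0 := Num.min A0' x.
have A0x : A0 <= x by rewrite ge_min lexx orbT.
(* Left of [A0] the small tail of the density bounds the solution for every [kappa]; a large [kappa]
   is exploited only on the compact rest [[A0, x]]. *)
have early kappa h : Re kappa <= 0 ->
    (forall y, is_derive_cplx h y (kappa * h y + a y)) -> cvanishing h ->
    forall y, y <= A0 -> nc (h y) <= th / 2.
  move=> k0 dh vh y yA.
  have dBM (t : R) : is_derive t 1 (fun y => B * M y) (B * m t).
    exact: (der_scale _ (dM _)).
  have BM0 (t : R) : 0 <= B * M t by rewrite mulr_ge0.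
  apply: (@le_trans _ _ (2 * (B * M y))).
    apply: (scalar_bound k0 vh dh dBM BM0) => t _.
    by apply: le_trans (am t) _; rewrite lerDl oppr_ge0 mulr_le0_ge0.
  have yA' : y <= A0' by apply: le_trans yA _; rewrite ge_min lexx.
  have := hA0 y yA'; rewrite ger0_norm// ler_pdivlMr ?mulr_gt0//.
  by have := M0 y; lra.
(* A constant density of mass at most 1 on [[A0, x]], against which the small source of [w] is
   measured; the summand 1 covers [A0 = x]. *)
pose s := (x - A0 + 1)^-1.
have s0 : 0 < s by rewrite invr_gt0 ltr_wpDl// subr_ge0.
have sx : s * (x - A0) <= 1.
  by rewrite mulrC ler_pdivrMr ?ltr_wpDl ?subr_ge0// mul1r lerDl.
have s1 : s <= 1 by rewrite invf_le1 ?lerDr ?subr_ge0// ltr_wpDl ?subr_ge0.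
clearbody s.
have st0 : 0 < s * th by rewrite mulr_gt0.
have st4 : 0 < s * th / 4 by rewrite divr_gt0.
have sth : s * th <= th by rewrite ler_piMl// ltW.
have [v1 [v1' [dv1 [K1 K10 hK1]]]] := C1_approximation A0x ac.1 st4.
have [v2 [v2' [dv2 [K2 K20 hK2]]]] := C1_approximation A0x ac.2 st4.
pose v y := v1 y +i* v2 y; pose v' y := v1' y +i* v2' y.
have dv y : is_derive_cplx v y (v' y) by split; [exact: dv1|exact: dv2].
pose K := K1 + K2.
have K0 : 0 <= K by exact: addr_ge0.
have vK y : A0 <= y <= x -> [/\ nc (a y - v y) <= s * th / 2, nc (v y) <= K & nc (v' y) <= K].
  move=> yA; have [p1 p2 p3] := hK1 y yA; have [r1 r2 r3] := hK2 y yA.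
  split; apply: le_trans (normc_le_ReIm _) _; rewrite ?ReImE /= /K; lra.
exists (2 * K / (s * th)) => kappa h k0 kL dh vh y yx.
have nk0 : 0 < nc kappa.
  by apply: le_lt_trans kL; rewrite divr_ge0 ?(ltW st0)// mulr_ge0.
have kne : kappa != 0.
  by apply: contraTneq nk0 => ->; rewrite Normc.normc0 ltxx.
have Kk : K / nc kappa <= s * th / 2.
  by rewrite ler_pdivrMr//; move: kL; rewrite ltr_pdivrMr//; lra.
have [yA|Ay] := leP y A0.
  by have := early kappa h k0 dh vh y yA; lra.
pose w t := h t + kappa^-1 * v t.
have nw t : A0 <= t <= x -> nc (kappa^-1 * v t) <= s * th / 2.
  move=> tA; have [_ h2 _] := vK t tA.
  rewrite Normc.normcM Normc.normcV mulrC; apply: le_trans Kk.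
  by rewrite ler_pM2r ?invr_gt0.
pose F t := a t - v t + kappa^-1 * v' t.
have sol : solves (fun=> kappa) (fun _ _ _ => 0) (fun=> F) (fun=> w).
  move=> k t; apply: cder_eq (cder_add (dh t) (cder_scale kappa^-1 (dv t))) _.
  rewrite big1 => [|j _]; last by rewrite mul0r.
  rewrite /w /F mulrDr mulrA divff// mul1r; ring.
have FB t : A0 <= t <= y -> nc (F t) <= th * s.
  move=> /andP[tA ty]; have tAx : A0 <= t <= x by rewrite tA (le_trans ty).
  have [h1 _ h3] := vK t tAx; apply: le_trans (le_normcD _ _) _.
  have : nc (kappa^-1 * v' t) <= s * th / 2.
    rewrite Normc.normcM Normc.normcV mulrC; apply: le_trans Kk.
    by rewrite ler_pM2r ?invr_gt0.
  lra.
have ds (t : R) : is_derive t 1 (fun t => s * t) s.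
  exact: der_linear.
have := energy_estimate (M := fun t => s * t) (m := fun=> s) (e := th) (ltW Ay) sol (fun=> k0) (fun t _ => ds t).
move=> /(_ _ (ltW th0) (fun _ t => FB t)) H.
have {}H := H (fun _ _ t _ => _).
have {}H : energy (fun=> w) y + th ^+ 2 <= (energy (fun=> w) A0 + th ^+ 2) * E.
  have nc0s : nc (0 : C) <= s by rewrite Normc.normc0 ltW.
  apply: le_trans (H nc0s) _; rewrite ler_wpM2l ?addr_ge0 ?energy_ge0 ?sqr_ge0// ler_expR.
  rewrite -mulrBr -[leRHS]mulr1 ler_wpM2l//; apply: le_trans sx.
  by rewrite ler_pM2l// lerD2r.
rewrite !energy_const in H.
have wA : nc (w A0) <= th.
  apply: le_trans (le_normcD _ _) _.
  have := early kappa h k0 dh vh A0 (lexx _).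
  have : nc (kappa^-1 * v A0) <= s * th / 2 by apply: nw; rewrite lexx.
  lra.
have wA2 : nc (w A0) ^+ 2 <= th ^+ 2.
  by rewrite ler_pXn2r ?nnegrE ?normc_ge0// ltW.
have wy : nc (w y) <= e / 2.
  rewrite -(@ler_pXn2r _ 2) ?nnegrE ?normc_ge0 ?divr_ge0 ?(ltW e0)//.
  have h1 : (4 * nc (w A0) ^+ 2 + th ^+ 2) * E <= (5 * th ^+ 2) * E.
    by rewrite ler_pM2r//; lra.
  have h2 : (5 * th ^+ 2) * E <= 5 * (th * E) ^+ 2.
    have E2 : th ^+ 2 * E <= th ^+ 2 * E ^+ 2.
      by rewrite ler_wpM2l ?sqr_ge0// expr2 ler_peMr// ltW.
    by rewrite exprMn -mulrA ler_pM2l.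
  rewrite thE in h2; have := sqr_ge0 th.
  have -> : (e / 2) ^+ 2 = 4 * (e / 4) ^+ 2 by field.
  have := sqr_ge0 (e / 4); lra.
have -> : h y = w y - kappa^-1 * v y by rewrite /w addrK.
apply: le_trans (le_normcD _ _) _; rewrite normcN.
have : nc (kappa^-1 * v y) <= s * th / 2 by apply: nw; rewrite yx ltW.
lra.
Qed.

End RiemannLebesgue.

(** * Columns of the Jost solutions for complex spectral parameter *)

Section Column.
Context {R : realType}.
Local Notation C := R[i].
Local Notation Re := complex.Re.
Local Notation Im := complex.Im.
Local Notation nc := Normc.normc.
Variables (c : R) (D : 'I_4 -> bool) (A : 'I_4 -> 'I_4 -> R -> C).
Variables (m M : R -> R) (e : 'I_4 -> C).
Implicit Types (x y : R) (z w : C) (g h : 'I_4 -> R -> C).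

(** For the Jost columns [c] is [3 * c1], and [D] marks the rows whose eigenvalue of [sigma] differs
    from that of the column. *)
Definition rate w (k : 'I_4) : C := if D k then (0 +i* c) * w else 0.

Definition column_solution w g :=
  solves (rate w) A (fun _ _ => 0) g /\ forall k, cvanishing (fun y => g k y - e k).

Hypotheses (c0 : 0 < c) (dm : density m M) (Ac : forall k j, ccont (A k j))
  (Am : forall k j y, nc (A k j y) <= m y)
  (De : forall k, D k -> e k = 0) (e1 : forall k, nc (e k) <= 1).

Lemma rate_Re w k : 0 <= Im w -> Re (rate w k) <= 0.
Proof.
move=> w0; rewrite /rate; case: (D k) => //=.
by rewrite ReM /= mul0r sub0r oppr_le0 mulr_ge0// ltW.
Qed.

Lemma rate_sub w z k : rate w k - rate z k = if D k then (0 +i* c) * (w - z) else 0.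
Proof. by rewrite /rate; case: (D k); rewrite ?mulrBr ?subr0. Qed.

Lemma normc_rate_sub w z k : nc (rate w k - rate z k) <= c * nc (w - z).
Proof.
rewrite rate_sub; case: (D k).
  rewrite Normc.normcM /= expr0n add0r sqrtr_sqr ger0_norm//; exact: ltW.
by rewrite Normc.normc0 mulr_ge0 ?normc_ge0// ltW.
Qed.

Lemma sum_A_le (a : 'I_4 -> C) (K y : R) k :
  (forall j, nc (a j) <= K) -> nc (\sum_(j < 4) A k j y * a j) <= 4 * K * m y.
Proof.
move=> aK; apply: le_trans (normc_sum _ _) _.
have -> : 4 * K * m y = \sum_(j < 4) m y * K.
  by rewrite sumr_const card_ord -[_ *+ 4]mulr_natl; ring.
by apply: ler_sum => j _; rewrite Normc.normcM ler_pM ?normc_ge0.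
Qed.

Lemma normc_le1_energy g k y : nc (g k y) <= 1 + energy g y.
Proof.
have := normc_le_energy g k y; have := sqr_ge0 (nc (g k y) - 1).
have := normc_ge0 (g k y); rewrite sqrrB mulr1 expr1n; nra.
Qed.

(** Subtracting the limit makes the unknown vanish at [-oo]. Since [rate w k * e k = 0], the only
    new source is [A e], which is dominated by [4 * m]. *)
Lemma column_deviation w g : column_solution w g ->
  solves (rate w) A (fun k y => \sum_(j < 4) A k j y * e j) (fun k y => g k y - e k).
Proof.
move=> [sol van] k x; apply: cder_eq (cder_sub (sol k x) (cder_cst (e k) x)) _.
under [X in _ = _ + X + _]eq_bigr do rewrite mulrBr.
rewrite big_split /= sumrN.
have -> : rate w k * (g k x - e k) = rate w k * g k x.
  rewrite mulrBr; have [Dk|nDk] := boolP (D k); first by rewrite De// mulr0 subr0.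
  by rewrite /rate (negPf nDk) !mul0r subr0.
ring.
Qed.

Lemma column_exists w : 0 <= Im w -> exists g, column_solution w g.
Proof.
move=> w0; have [d [sd vd]] : exists d, solves (rate w) A
    (fun k y => \sum_(j < 4) A k j y * e j) d /\ forall k, cvanishing (d k).
  apply: (system_solution dm (fun k => rate_Re k w0) Ac Am _ (ler0n _ 4)) => k.
    by apply: ccont_sum => j; apply: ccont_mul => //; exact: ccont_cst.
  by move=> y; apply: le_trans (sum_A_le y k e1) _; rewrite mulr1.
exists (fun k y => d k y + e k); split => k.
  move=> x; apply: cder_eq (cder_add (sd k x) (cder_cst (e k) x)) _.
  under [X in _ = _ + X + _]eq_bigr do rewrite mulrDr.
  rewrite big_split /=.
  have -> : rate w k * (d k x + e k) = rate w k * d k x.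
    rewrite mulrDr; have [Dk|nDk] := boolP (D k); first by rewrite De// mulr0 addr0.
    by rewrite /rate (negPf nDk) !mul0r addr0.
  ring.
have := vd k; congr cvanishing; apply/funext => y; by rewrite addrK.
Qed.

(** The 4 is the bound of the source [A e]: four entries dominated by [m] against components of
    modulus at most 1. *)
Lemma column_energy w g x : 0 <= Im w -> column_solution w g ->
  energy (fun k y => g k y - e k) x + 4 ^+ 2 <= 4 ^+ 2 * expR (9 * M x).
Proof.
move=> w0 gw; apply: (energy_estimate_Ny (column_deviation gw) (fun k => rate_Re k w0)
  dm Am (ler0n _ _) _ gw.2).
by move=> k y _; apply: le_trans (sum_A_le y k e1) _; rewrite mulr1.
Qed.

Lemma column_bound w g x k : 0 <= Im w -> column_solution w g ->
  nc (g k x) <= 16 * expR (9 * M x).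
Proof.
move=> w0 gw; have H := column_energy x w0 gw.
have h1 := @normc_le1_energy (fun k y => g k y - e k) k x.
apply: le_trans (normc_triB (g k x) (e k)) _.
have := e1 k; have -> : (16 : R) = 4 ^+ 2 by rewrite -natrX.
have : (4 : R) ^+ 2 = 16 by rewrite -natrX.
lra.
Qed.

Lemma column_unique w g h k x : 0 <= Im w ->
  column_solution w g -> column_solution w h -> g k x = h k x.
Proof.
move=> w0 [sg vg] [sh vh].
have sol : solves (rate w) A (fun _ _ => 0) (fun k y => g k y - h k y).
  move=> j y; apply: cder_eq (cder_sub (sg j y) (sh j y)) _.
  under [X in _ = _ + X + _]eq_bigr do rewrite mulrBr.
  by rewrite big_split /= sumrN; ring.
have van j : cvanishing (fun y => g j y - h j y).
  have := cvanishing_sub (vg j) (vh j); congr cvanishing; apply/funext => y; ring.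
have := energy_estimate_Ny sol (fun k => rate_Re k w0) dm Am (lexx 0) _ van (x := x).
rewrite expr0n mul0r addr0 => H.
have {}H : energy (fun k y => g k y - h k y) x <= 0.
  by apply: H => j y _; rewrite Normc.normc0 mul0r.
apply/eqP; rewrite -subr_eq0; apply/eqP/normc_eq0.
have := le_trans (normc_le_energy (fun k y => g k y - h k y) k x) H.
by rewrite exprn_even_le0//= => /eqP ->.
Qed.

(** The bound of [column_energy] does not involve [w], so one [B] serves all parameters;
    [ln (1 + t / 16) / 9] is the value of [M] at which [16 * (expR (9 * M) - 1)] equals [t]. *)
Lemma column_energy_uniform (t : R) : 0 < t -> exists B, forall w g x,
  0 <= Im w -> column_solution w g -> x <= B -> energy (fun k y => g k y - e k) x <= t.
Proof.
move=> t0; have l0 : 0 < ln (1 + t / 16) / 9.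
  by rewrite divr_gt0// ln_gt0// ltrDl divr_gt0.
have [B hB] := density_van dm l0; exists B => w g x w0 gw /hB.
rewrite ger0_norm ?(density_prim_ge0 dm)// ler_pdivlMr// => MB.
have := column_energy x w0 gw.
have : expR (9 * M x) <= 1 + t / 16.
  rewrite -[leRHS]lnK ?posrE; last by rewrite addr_gt0// divr_gt0.
  by rewrite ler_expR mulrC.
have -> : (4 : R) ^+ 2 = 16 by rewrite -natrX.
lra.
Qed.

(* [rate w - rate z] times the solution at [z] is not integrable at [-oo]: the
   energies are compared on [[a, x]] only, both being small at [a]. *)
Lemma column_continuous z gz x (t : R) : 0 <= Im z -> column_solution z gz -> 0 < t ->
  exists2 dl, 0 < dl & forall w g, 0 <= Im w -> column_solution w g ->
    nc (w - z) <= dl -> energy (fun k y => g k y - gz k y) x <= t.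
Proof.
move=> z0 gzs t0; have M0 := density_prim_ge0 dm; have [dM mc m0 Mv _] := dm.
pose E := expR (9 * (M x + 1)).
have E0 : 0 < E by exact: expR_gt0.
have tE : 0 < t / (8 * E) by rewrite divr_gt0 ?mulr_gt0.
have [B hB] := column_energy_uniform tE.
pose a := Num.min B x.
have aB : a <= B by rewrite ge_min lexx.
have ax : a <= x by rewrite ge_min lexx orbT.
(* On [[a, x]] the density [m] is enlarged by this constant, of mass at most 1, to absorb the
   source; hence [M x + 1] in [E]. *)
pose s := (x - a + 1)^-1.
have s0 : 0 < s by rewrite invr_gt0 ltr_wpDl// subr_ge0.
have sx : s * (x - a) <= 1.
  by rewrite mulrC ler_pdivrMr ?ltr_wpDl ?subr_ge0// mul1r lerDl.
pose K := 16 * expR (9 * M x).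
have K0 : 0 < K by rewrite mulr_gt0 ?expR_gt0.
have hK y : y <= x -> 16 * expR (9 * M y) <= K.
  by move=> yx; rewrite ler_pM2l// ler_expR ler_pM2l// (density_le dm).
clearbody K s.
(* The budget [t] is halved: the initial energy, at most [4 * (t / (8 * E))], gives one half after
   the factor [E], and [u ^+ 2 <= u] gives the other. *)
pose u := Num.min 1 (t / (2 * E)).
have u0 : 0 < u by rewrite lt_min ltr01 divr_gt0 ?mulr_gt0.
have u1 : u <= 1 by rewrite ge_min lexx.
have u2 : u <= t / (2 * E) by rewrite ge_min lexx orbT.
clearbody u.
exists (u * s / (c * K)); first by rewrite divr_gt0 ?mulr_gt0.
move=> w g w0 gs wz.
have sol : solves (rate w) A (fun k y => (rate w k - rate z k) * gz k y)
    (fun k y => g k y - gz k y).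
  move=> j y; apply: cder_eq (cder_sub (gs.1 j y) (gzs.1 j y)) _.
  under [X in _ = _ + X + _]eq_bigr do rewrite mulrBr.
  by rewrite big_split /= sumrN; ring.
have ds y : is_derive y 1 (fun y => M y + s * y) (m y + s).
  exact: der_add (dM y) (der_linear s y).
have := @energy_estimate R (rate w) A _ _ (fun y => m y + s) (fun y => M y + s * y) u a x
  ax sol (fun k => rate_Re k w0) (fun y _ => ds y) _ (ltW u0) _.
move=> H.
have {}H : energy (fun k y => g k y - gz k y) x + u ^+ 2 <=
    (energy (fun k y => g k y - gz k y) a + u ^+ 2) * E.
  apply: le_trans (H _ _) _.
  - by move=> k j y _; apply: le_trans (Am k j y) _; rewrite lerDl ltW.
  - move=> k y /andP[ay yx]; rewrite Normc.normcM.
    apply: (@le_trans _ _ (c * nc (w - z) * K)).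
      rewrite ler_pM ?normc_ge0 ?normc_rate_sub//.
      by apply: le_trans (column_bound y k z0 gzs) _; exact: hK.
    rewrite ler_pdivlMr ?mulr_gt0// in wz.
    have := mulr_ge0 (ltW u0) (m0 y); lra.
  - rewrite ler_wpM2l ?addr_ge0 ?energy_ge0 ?sqr_ge0// ler_expR ler_pM2l//.
    by have := M0 a; lra.
have Ea : energy (fun k y => g k y - gz k y) a <= 4 * (t / (8 * E)).
  have h1 := hB w g a w0 gs aB; have h2 := hB z gz a z0 gzs aB.
  apply: (@le_trans _ _ (2 * energy (fun k y => g k y - e k) a +
     2 * energy (fun k y => gz k y - e k) a)); last lra.
  rewrite /energy !mulr_sumr -big_split /=; apply: ler_sum => k _.
  have -> : g k a - gz k a = (g k a - e k) - (gz k a - e k) by ring.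
  have h := le_normcD (g k a - e k) (- (gz k a - e k)); rewrite normcN in h.
  have := sqr_ge0 (nc (g k a - e k) - nc (gz k a - e k)).
  have : nc (g k a - e k - (gz k a - e k)) ^+ 2 <= (nc (g k a - e k) + nc (gz k a - e k)) ^+ 2.
    by rewrite ler_pXn2r ?nnegrE ?addr_ge0 ?normc_ge0.
  rewrite sqrrB sqrrD; lra.
have u22 : u ^+ 2 <= t / (2 * E) by apply: le_trans u2; rewrite expr2 ler_piMr// ltW.
have h3 : (energy (fun k y => g k y - gz k y) a + u ^+ 2) * E <= t.
  have -> : t = (4 * (t / (8 * E)) + t / (2 * E)) * E by field; rewrite gt_eqF.
  by rewrite ler_pM2r// lerD.
by have := sqr_ge0 u; lra.
Qed.

(* For [Im z > 0] the components with [D k] are dominated by an integrable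
   density, so the equation differentiated in [z] has an admissible source, and
   the difference quotient is compared with its solution [g']. *)
Lemma column_derivative z gz : 0 < Im z -> column_solution z gz ->
  exists g', forall k x (t : R), 0 < t ->
    exists2 dl, 0 < dl & forall w g, 0 <= Im w -> column_solution w g ->
      w != z -> nc (w - z) <= dl ->
      nc ((g k x - gz k x) / (w - z) - g' k x) <= t.
Proof.
move=> z0 gzs; have z0' := ltW z0.
have [_ mc m0 _ [Mt hMt]] := dm.
pose b := c * Im z.
have b0 : 0 < b by rewrite mulr_gt0.
have rb k : D k -> Re (rate z k) = - b.
  by move=> Dk; rewrite /rate Dk ReM /= mul0r sub0r.
pose K1 := 16 * expR (9 * Mt).
have K10 : 0 <= K1 by rewrite mulr_ge0 ?expR_ge0.
have gzK k y : nc (gz k y) <= K1.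
  apply: le_trans (column_bound y k z0' gzs) _.
  by rewrite ler_pM2l// ler_expR ler_pM2l.
(* On [D] each [gz k] solves a scalar equation damped at rate [b], with source at most
   [4 * K1 * m]. *)
have [p1 [P1 [dp1 hp1]]] := damped_density dm b0 (mulr_ge0 (ler0n _ 4) K10).
have gzp k y : D k -> nc (gz k y) <= p1 y.
  move=> Dk; apply: (hp1 (rate z k) (gz k) _ (rb k Dk)).
  - have := gzs.2 k; rewrite De//; congr cvanishing; apply/funext => t; exact: subr0.
  - move=> t; apply: cder_eq (gzs.1 k t) _; rewrite addr0; reflexivity.
  - by move=> t; apply: sum_A_le.
have dmp := density_add dm dp1.
have p10 := density_ge0 dp1.
(* The derivative of [rate z k] in [z], times [gz k]. *)
pose f1 k y : C := if D k then (0 +i* c) * gz k y else 0.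
have f1c k : ccont (f1 k).
  rewrite /f1; case: (D k); last exact: ccont_cst.
  apply: ccont_mul; [exact: ccont_cst|exact: cder_ccont (gzs.1 k)].
have nic : nc (0 +i* c) = c by rewrite /= expr0n add0r sqrtr_sqr ger0_norm// ltW.
have f1p k y : nc (f1 k y) <= c * (m y + p1 y).
  rewrite /f1; case: ifP => Dk; last by rewrite Normc.normc0 mulr_ge0 ?addr_ge0// ltW.
  rewrite Normc.normcM nic ler_pM2l//; apply: le_trans (gzp k y Dk) _.
  by rewrite lerDr.
have Amp k j y : nc (A k j y) <= m y + p1 y by apply: le_trans (Am k j y) _; rewrite lerDl.
have [g' [sg' vg']] := system_solution dmp (fun k => rate_Re k z0') Ac Amp f1c (ltW c0) f1p.
have [_ _ _ _ [Mt2 hMt2]] := dmp.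
pose K2 := 1 + c ^+ 2 * expR (9 * Mt2).
have K20 : 0 <= K2 by rewrite addr_ge0// mulr_ge0 ?sqr_ge0 ?expR_ge0.
have g'K k y : nc (g' k y) <= K2.
  apply: le_trans (normc_le1_energy g' k y) _; rewrite lerD2l.
  have H := @energy_estimate_Ny R _ _ _ _ _ _ c y sg' (fun k => rate_Re k z0') dmp Amp (ltW c0)
    (fun k y _ => f1p k y) vg'.
  apply: (@le_trans _ _ (c ^+ 2 * expR (9 * (M y + P1 y)))).
    by apply: le_trans H; rewrite lerDl sqr_ge0.
  by rewrite ler_wpM2l ?sqr_ge0// ler_expR ler_pM2l.
have K3 : 0 <= 4 * K2 + c by rewrite addr_ge0 ?mulr_ge0// ltW.
(* A second round of damping, now for [g']: its components in [D] reappear as source in the equation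
   for the error of the difference quotient. *)
have [p2 [P2 [dp2 hp2]]] := damped_density dmp b0 K3.
have g'p k y : D k -> nc (g' k y) <= p2 y.
  move=> Dk; apply: (hp2 (rate z k) (g' k) _ (rb k Dk) (vg' k)).
    by move=> t; apply: cder_eq (sg' k t) _; rewrite -addrA; reflexivity.
  move=> t; apply: le_trans (le_normcD _ _) _; rewrite mulrDl lerD//.
  apply: le_trans (sum_A_le t k (fun j => g'K j t)) _.
  by rewrite ler_wpM2l ?mulr_ge0// lerDl.
have dmp2 := density_add dm dp2.
have p20 := density_ge0 dp2.
have Amp2 k j y : nc (A k j y) <= m y + p2 y by apply: le_trans (Am k j y) _; rewrite lerDl.
exists g' => k x t t0.
pose E := expR (9 * (M x + P2 x)).
have E1 : 1 <= E.
  rewrite -expR0 ler_expR mulr_ge0// addr_ge0//; [exact: density_prim_ge0 dm _|exact: density_prim_ge0 dp2 _].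
have E0 : 0 < E by exact: expR_gt0.
exists (t / (c * E)); first by rewrite divr_gt0 ?mulr_gt0.
move=> w g w0 gs wz wd; have wz0 : w - z != 0 by rewrite subr_eq0.
(* This error solves the system at [w] with a source of size [c * nc (w - z)] relative to the
   density [m + p2], hence is of first order in [w - z]. *)
pose r k y := (g k y - gz k y) / (w - z) - g' k y.
have sol : solves (rate w) A (fun k y => (rate w k - rate z k) * g' k y) r.
  move=> j y.
  have h1 := cder_scale (w - z)^-1 (cder_sub (gs.1 j y) (gzs.1 j y)).
  apply: cder_eq (cder_ext _ (cder_sub h1 (sg' j y))) _.
    by move=> v; rewrite /r mulrC.
  rewrite /r; under [X in _ = _ + X + _]eq_bigr do rewrite mulrBr mulrA mulrBr.
  rewrite big_split /= sumrN -mulr_suml big_split /= sumrN !addr0.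
  have -> : f1 j y = (rate w j - rate z j) / (w - z) * gz j y.
    rewrite rate_sub /f1; case: (D j); last by rewrite !mul0r.
    by rewrite mulfK.
  field; exact: wz0.
have rv j : cvanishing (r j).
  apply: cvanishing_sub (vg' j).
  have := cvanishing_scale (w - z)^-1 (cvanishing_sub (gs.2 j) (gzs.2 j)).
  congr cvanishing; apply/funext => y; rewrite mulrC; congr (_ / _); ring.
have e0 : 0 <= c * nc (w - z) by rewrite mulr_ge0 ?normc_ge0// ltW.
have H := @energy_estimate_Ny R _ _ _ _ _ _ (c * nc (w - z)) x sol (fun k => rate_Re k w0) dmp2 Amp2 e0 _ rv.
have {}H : energy r x <= (c * nc (w - z)) ^+ 2 * E.
  apply: le_trans (H _); first by rewrite lerDl sqr_ge0.
  move=> j y _; have [Dj|nDj] := boolP (D j).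
    rewrite Normc.normcM ler_pM ?normc_ge0 ?normc_rate_sub//.
    by apply: le_trans (g'p j y Dj) _; rewrite lerDr.
  by rewrite rate_sub (negPf nDj) mul0r Normc.normc0 mulr_ge0 ?addr_ge0.
rewrite -/(r k x) -(@ler_pXn2r _ 2) ?nnegrE ?normc_ge0 ?(ltW t0)//.
apply: le_trans (normc_le_energy r k x) _; apply: le_trans H _.
apply: (@le_trans _ _ ((c * nc (w - z) * E) ^+ 2)).
  by rewrite [leRHS]exprMn ler_wpM2l ?sqr_ge0// expr2 ler_peMr// ltW.
have ce : 0 <= c * nc (w - z) * E by rewrite mulr_ge0// ltW.
rewrite ler_pXn2r ?nnegrE ?(ltW t0)//.
by move: wd; rewrite ler_pdivlMr ?mulr_gt0// mulrC; lra.
Qed.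

Hypothesis Ae : forall k y, ~~ D k -> \sum_(j < 4) A k j y * e j = 0.

(** Let [H] solve the uncoupled equations with source [A e]. It is 0 outside [D] by [Ae], and small
    inside [D] by [riemann_lebesgue]. The remainder [g - e - H] then solves the full system with the
    small source [A H]. *)
Lemma column_at_infinity x k (t : R) : 0 < t -> exists L, forall w g,
  0 <= Im w -> column_solution w g -> L < nc w -> nc (g k x - e k) <= t.
Proof.
move=> t0; have M0 := density_prim_ge0 dm; have [dM mc m0 Mv _] := dm.
pose a k y := \sum_(j < 4) A k j y * e j.
have ac j : ccont (a j) by apply: ccont_sum => i; apply: ccont_mul => //; exact: ccont_cst.
have am j y : nc (a j y) <= 4 * m y.
  by apply: le_trans (sum_A_le y j e1) _; rewrite mulr1.
pose E := expR (9 * M x).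
have E1 : 1 <= E by rewrite -expR0 ler_expR mulr_ge0.
have E0 : 0 < E by exact: expR_gt0.
(* The remainder is at most [4 * s * E = t / 2], and [H] at most [s <= t / 8]. *)
pose s := t / (8 * E).
have s0 : 0 < s by rewrite divr_gt0 ?mulr_gt0.
have /choice[L hL] : forall j : 'I_4, exists L : R, forall kappa (h : R -> C), Re kappa <= 0 -> L < nc kappa ->
    (forall y, is_derive_cplx h y (kappa * h y + a j y)) -> cvanishing h ->
    forall y, y <= x -> nc (h y) <= s.
  by move=> j; apply: (riemann_lebesgue _ dm (ac j) _ (am j) s0).
pose Lm := \sum_(j < 4) `|L j|.
have LLm j : L j <= Lm.
  rewrite /Lm (bigD1 j)//=; apply: le_trans (ler_norm _) _; rewrite lerDl.
  by apply: sumr_ge0 => i _.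
exists (Lm / c) => w g w0 gs wL.
have nr j : D j -> L j < nc (rate w j).
  move=> Dj; apply: le_lt_trans (LLm j) _; rewrite /rate Dj Normc.normcM.
  by rewrite /= expr0n add0r sqrtr_sqr (ger0_norm (ltW c0)) mulrC -ltr_pdivrMr.
have /choice[H hH] : forall j, exists h : R -> C, [/\ forall y, is_derive_cplx h y (rate w j * h y + a j y),
    cvanishing h & forall y, y <= x -> nc (h y) <= s].
  move=> j; have [Dj|nDj] := boolP (D j).
    have [h [dh vh]] := scalar_solution dm (rate_Re j w0) (ac j) (ler0n _ 4) (fun y _ => am j y).
    by exists h; split => //; apply: (hL j) (rate_Re j w0) (nr j Dj) dh vh.
  exists (fun=> 0); split.
  - move=> y; apply: cder_eq (cder_cst 0 y) _; by rewrite mulr0 add0r /a Ae.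
  - by move=> r r0; exists 0 => y _; rewrite Normc.normc0 normr0 ltW.
  - by move=> y _; rewrite Normc.normc0 ltW.
pose d j y := g j y - e j - H j y.
have sol : solves (rate w) A (fun j y => \sum_(i < 4) A j i y * H i y) d.
  move=> j y; have [dH _ _] := hH j.
  apply: cder_eq (cder_sub (column_deviation gs j y) (dH y)) _.
  rewrite /d; under [X in _ = _ + X + _]eq_bigr do rewrite mulrBr.
  by rewrite big_split /= sumrN /a; ring.
have dv j : cvanishing (d j) by apply: cvanishing_sub; [exact: gs.2|have [] := hH j].
have K := @energy_estimate_Ny R _ _ _ _ _ _ (4 * s) x sol (fun k => rate_Re k w0) dm Am _ _ dv.
have {}K : energy d x <= (4 * s) ^+ 2 * E.
  apply: le_trans (K _ _); first by rewrite lerDl sqr_ge0.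
    by rewrite mulr_ge0// ltW.
  by move=> j y yx; apply: sum_A_le => i; have [_ _] := hH i; apply.
have -> : g k x - e k = d k x + H k x by rewrite /d subrK.
apply: le_trans (le_normcD _ _) _.
have sE : s * E = t / 8 by rewrite /s; field; rewrite gt_eqF.
have st : s <= t / 8 by rewrite -sE ler_peMr// ltW.
have [_ _ /(_ x (lexx _)) hx] := hH k.
have dx : nc (d k x) <= t / 2.
  rewrite -(@ler_pXn2r _ 2) ?nnegrE ?normc_ge0 ?divr_ge0 ?(ltW t0)//.
  apply: le_trans (normc_le_energy d k x) _; apply: le_trans K _.
  have -> : t / 2 = 4 * s * E by rewrite -mulrA sE; field.
  by rewrite [leRHS]exprMn ler_wpM2l ?sqr_ge0// expr2 ler_peMr// ltW.
lra.
Qed.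

End Column.

(** * Topology of the complex plane and integrable densities *)

Section Bridge.
Context {R : realType}.
Local Notation C := (R[i]^o).
Local Notation Re := complex.Re.
Local Notation Im := complex.Im.
Local Notation nc := Normc.normc.
Implicit Types (A U : set C) (f : C -> C) (z w l : C).

Lemma normcE_lt z (t : R) : (`|z : R[i]| < t%:C) = (nc z < t).
Proof. by rewrite normc_def ltcR; case: z. Qed.

Lemma normcE_le z (t : R) : (`|z : R[i]| <= t%:C) = (nc z <= t).
Proof. by rewrite normc_def lecR; case: z. Qed.

Lemma gt0_real_complex (t : R[i]) : 0 < t -> exists2 s : R, 0 < s & t = s%:C.
Proof. by case: t => a b; rewrite ltcE /= => /andP[/eqP -> a0]; exists a. Qed.

Lemma near_normc z (t : R) : 0 < t -> \forall w \near z, nc (w - z) <= t.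
Proof.
move=> t0; have t0' : (0 : R[i]) < t%:C by rewrite ltcR.
apply/nbhs_ballP; exists t%:C => //= w; rewrite /ball /= /ball_ distrC normcE_lt.
exact: ltW.
Qed.

Lemma cvg_normc (T : Type) (F : set_system T) {FF : Filter F} (f : T -> C) l :
  (forall t : R, 0 < t -> \forall w \near F, nc (f w - l) <= t) -> f @ F --> l.
Proof.
move=> H; apply/cvgrPdist_le => t /gt0_real_complex[s s0 ->].
by apply: filterS (H s s0) => w; rewrite -normcE_le distrC.
Qed.

Lemma cvg_normcP (T : Type) (F : set_system T) {FF : Filter F} (f : T -> C) l :
  f @ F --> l -> forall t : R, 0 < t -> \forall w \near F, nc (f w - l) <= t.
Proof.
move=> fl t t0; have t0' : (0 : R[i]) < t%:C by rewrite ltcR.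
move/cvgrPdist_le: fl => /(_ _ t0'); apply: filterS => w.
by rewrite -normcE_le distrC.
Qed.

Lemma within_continuous_normc A f :
  (forall z, A z -> forall t : R, 0 < t -> exists2 d : R, 0 < d &
    forall w, A w -> nc (w - z) <= d -> nc (f w - f z) <= t) ->
  {within A, continuous f}.
Proof.
move=> H; apply/subspace_continuousP => z Az.
apply: cvg_normc => t t0; have [d d0 hd] := H z Az t t0.
rewrite near_withinE; apply: filterS (near_normc z d0) => w wz Aw.
exact: hd.
Qed.

(** Difference quotients are controlled only for increments that stay in [A]; the first hypothesis
    says that near a point of [U] all of them do. *)
Lemma derivable_normc A U f (f' : C -> C) :
  (forall z, U z -> exists2 r : R, 0 < r & forall w, nc (w - z) <= r -> A w) ->
  (forall z, U z -> forall t : R, 0 < t -> exists2 d : R, 0 < d &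
    forall w, A w -> w != z -> nc (w - z) <= d ->
      nc ((f w - f z) / (w - z) - f' z) <= t) ->
  forall z, U z -> derivable f z 1.
Proof.
move=> HU H z Uz; apply: (cvgP (f' z : C)); apply: cvg_normc => t t0.
have [r r0 hr] := HU z Uz; have [d d0 hd] := H z Uz t t0.
have hz : (0 : C) != 0 -> False by rewrite eqxx.
rewrite near_withinE /=.
have rd : 0 < Num.min r d by rewrite lt_min r0.
apply: filterS (near_normc (0 : C) rd) => h; rewrite subr0 le_min => /andP[h1 h2] h0.
have e1 : h *: (1 : C) + z - z = h by rewrite addrK /GRing.scale /= mulr1.
have := hd (h *: (1 : C) + z); rewrite e1 => K.
have -> : h^-1 *: (f (h *: (1 : C) + z) - f z) = (f (h *: (1 : C) + z) - f z) / h.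
  by rewrite mulrC.
apply: K => //; first by apply: hr; rewrite e1.
by rewrite -subr_eq0 e1.
Qed.

Lemma cvg_infty_in A f l :
  (forall t : R, 0 < t -> exists L : R, forall w, A w -> L < nc w -> nc (f w - l) <= t) ->
  f @ infty_in A --> l.
Proof.
move=> H V /nbhs_ballP[t /= /gt0_real_complex[s s0 ->] hV].
have s2 : 0 < s / 2 by rewrite divr_gt0.
have [L hL] := H _ s2; exists L => // w /= [Aw Lw]; apply: hV.
rewrite /ball /= /ball_ distrC normcE_lt; apply: le_lt_trans (hL w Aw Lw) _; lra.
Qed.

Lemma cvg_Ny_vanishing (f : R -> C) l : f @ -oo --> l -> cvanishing (fun x => f x - l).
Proof.
move=> /cvg_normcP H e e0; have [B [_ hB]] := H e e0.
exists (B - 1) => y yB; rewrite ger0_norm ?normc_ge0//; apply: hB; lra.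
Qed.

Lemma cvg_y_vanishing (f : R -> C) l : f @ +oo --> l -> cvanishing (fun x => f (- x) - l).
Proof. by move=> /cvgy_compNP; exact: cvg_Ny_vanishing. Qed.

Lemma continuous_ccont (f : R -> C) : continuous f -> ccont f.
Proof.
move=> fc; split=> x; apply/cvgrPdist_le => e e0; have H := cvg_normcP (fc x) e0.
  near=> y; have h : nc (f y - f x) <= e by near: y; exact: H.
  by have := le_trans (normr_Re_le _) h; rewrite ReD ReN distrC.
near=> y; have h : nc (f y - f x) <= e by near: y; exact: H.
by have := le_trans (normr_Im_le _) h; rewrite ImD ImN distrC.
Unshelve. all: by end_near. Qed.

Lemma density_0 : @density R (fun=> 0) (fun=> 0).
Proof.
split=> //; [by move=> x; exact: der_cst|by move=> x; exact: cst_continuous| |by exists 0].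
by move=> e e0; exists 0 => y _; rewrite normr0 ltW.
Qed.

Lemma density_sum (I : Type) (r : seq I) (m M : I -> R -> R) :
  (forall i, density (m i) (M i)) ->
  density (fun x => \sum_(i <- r) m i x) (fun x => \sum_(i <- r) M i x).
Proof.
move=> dm; elim: r => [|i r IH].
  have -> : (fun x => \sum_(i <- [::]) m i x) = (fun=> 0 : R).
    by apply/funext => x; rewrite big_nil.
  have -> : (fun x => \sum_(i <- [::]) M i x) = (fun=> 0 : R).
    by apply/funext => x; rewrite big_nil.
  exact: density_0.
have -> : (fun x => \sum_(i <- i :: r) m i x) = (fun x => m i x + \sum_(i <- r) m i x).
  by apply/funext => x; rewrite big_cons.
have -> : (fun x => \sum_(i <- i :: r) M i x) = (fun x => M i x + \sum_(i <- r) M i x).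
  by apply/funext => x; rewrite big_cons.
exact: density_add.
Qed.

Lemma integrable_primitive_bounded (h : R -> R) : continuous h -> (forall x, 0 <= h x) ->
  (@lebesgue_measure R).-integrable setT (EFin \o h) ->
  exists F : R -> R, (forall x : R, is_derive x 1 F (h x)) /\
    exists B, forall x, 0 <= F x <= B.
Proof.
move=> hc h0 hi; set mu := @lebesgue_measure R.
have hiS y : mu.-integrable `]-oo, y] (EFin \o h).
  by apply: integrableS hi => //; exact: measurableT.
exists (fun x => \int[mu]_(t in `]-oo, x]) h t)%R; split.
  move=> x; have xx1 : x < x + 1 by rewrite ltrDl.
  have [d1 <-] := continuous_FTC1 xx1 (hiS (x + 1)) (ltNyr x) (hc x).
  by rewrite derive1E; apply: derivableP.
exists (\int[mu]_(t in setT) h t)%R => x; apply/andP; split.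
  by apply: Rintegral_ge0 => t _; exact: h0.
rewrite /Rintegral fine_le//.
- exact: integrable_fin_num.
- exact: integrable_fin_num.
- apply: ge0_subset_integral => //; first by case/integrableP: hi.
  by move=> t _; rewrite lee_fin.
Qed.

(** One bounded monotone primitive serves both ends of the line: [F] minus its infimum vanishes at
    [-oo], and its supremum minus [F (- x)] is the primitive for the reflected density. *)
Lemma integrable_density (h : R -> R) : continuous h -> (forall x, 0 <= h x) ->
  (@lebesgue_measure R).-integrable setT (EFin \o h) ->
  exists M M', density h M /\ density (fun x => h (- x)) M'.
Proof.
move=> hc h0 hi; have [F [dF [B FB]]] := integrable_primitive_bounded hc h0 hi.
have Fnd x y : x <= y -> F x <= F y.
  by move=> xy; apply: (@der_ndecr _ F h) => // z _; exact: dF.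
have infF : has_inf (range F).
  by split; [exists (F 0), 0|exists 0 => _ [x _ <-]; have /andP[] := FB x].
have supF : has_sup (range F).
  by split; [exists (F 0), 0|exists B => _ [x _ <-]; have /andP[] := FB x].
have infle x : inf (range F) <= F x by apply: ge_inf; [case: infF|exists x].
have lesup x : F x <= sup (range F) by apply: ub_le_sup; [case: supF|exists x].
exists (fun x => F x - inf (range F)), (fun x => sup (range F) - F (- x)); split; split => //.
- by move=> x; apply: is_derive_eq (der_sub (dF x) (der_cst x _)) _; rewrite subr0.
- move=> e e0; have [_ [a _ <-] Fa] := inf_adherent e0 infF; exists a => y ya.
  by rewrite ger0_norm ?subr_ge0//; have := Fnd y a ya; lra.
- by exists (B - inf (range F)) => x; rewrite lerB//; have /andP[] := FB x.
- move=> x; have dN := der_opp (der_id x).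
  apply: is_derive_eq (der_sub (der_cst x _) (der_comp dN (dF (- x)))) _.
  by rewrite mulrN1 sub0r opprK.
- by move=> x; apply: continuous_comp; [exact: opp_continuous|exact: hc].
- move=> e e0; have [_ [a _ <-] Fa] := sup_adherent e0 supF; exists (- a) => y ya.
  by rewrite ger0_norm ?subr_ge0//; have := Fnd a (- y); rewrite lerNr => /(_ ya); lra.
- by exists (sup (range F)) => x; have /andP[] := FB (- x); lra.
Qed.

End Bridge.

(** * Continuity, analyticity and limits on a half-plane, and their reflection *)

Section Regularity.
Context {R : realType}.
Local Notation C := (R[i]^o).
Local Notation Re := complex.Re.
Local Notation Im := complex.Im.
Local Notation nc := Normc.normc.
Implicit Types (A U : set C) (F : C -> C) (z w a : C).

(** Phrased with the real-valued modulus and with increments inside [A] only, a form in which the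
    three properties pass through conjugation together. *)
Record regular A U F a : Prop := Regular {
  regular_cont : forall z, A z -> forall t : R, 0 < t -> exists2 d : R, 0 < d &
    forall w, A w -> nc (w - z) <= d -> nc (F w - F z) <= t;
  regular_der : exists F' : C -> C, forall z, U z -> forall t : R, 0 < t ->
    exists2 d : R, 0 < d & forall w, A w -> w != z -> nc (w - z) <= d ->
      nc ((F w - F z) / (w - z) - F' z) <= t;
  regular_infty : forall t : R, 0 < t -> exists L : R, forall w, A w -> L < nc w ->
    nc (F w - a) <= t }.

Lemma upper_half_interior z : upper_half z -> exists2 r : R, 0 < r &
  forall w, nc (w - z) <= r -> closed_upper_half w.
Proof.
rewrite /upper_half /closed_upper_half /= => z0; exists (Im z) => // w wz.
have := le_trans (normr_Im_le (w - z)) wz; rewrite ImD ImN ler_norml; lra.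
Qed.

Lemma lower_half_interior z : lower_half z -> exists2 r : R, 0 < r &
  forall w, nc (w - z) <= r -> closed_lower_half w.
Proof.
rewrite /lower_half /closed_lower_half /= => z0; exists (- Im z) => [|w wz].
  by rewrite oppr_gt0.
have := le_trans (normr_Im_le (w - z)) wz; rewrite ImD ImN ler_norml; lra.
Qed.

(** Schwarz reflection: the difference quotient of the reflected function is the conjugate of that
    of [F] at the conjugate points. *)
Lemma regular_conj F a : regular closed_upper_half upper_half F a ->
  regular closed_lower_half lower_half (fun w => (F w^*)^*) a^*.
Proof.
have cl w : closed_lower_half w -> closed_upper_half (w^* : C).
  by rewrite /closed_lower_half /closed_upper_half /= ImJ oppr_ge0.
have cu w : lower_half w -> upper_half (w^* : C).
  by rewrite /lower_half /upper_half /= ImJ oppr_gt0.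
have ncJB (z w : R[i]) : nc (z^* - w^*) = nc (z - w) by rewrite -rmorphB normcJ.
move=> [cF [F' dF] iF]; split.
- move=> z Az t t0; have [d d0 hd] := cF _ (cl z Az) t t0; exists d => // w Aw wz.
  by rewrite ncJB; apply: hd; [exact: cl|rewrite ncJB].
- exists (fun w => (F' w^*)^*) => z Uz t t0.
  have [d d0 hd] := dF _ (cu z Uz) t t0; exists d => // w Aw wnz wz.
  rewrite -[w - z]conjcK -rmorphB -fmorphV -rmorphM -rmorphB normcJ rmorphB.
  apply: hd; [exact: cl| |by rewrite ncJB].
  by apply: contraNneq wnz => /(congr1 conjc); rewrite !conjcK => ->.
- move=> t t0; have [L hL] := iF t t0; exists L => w Aw Lw.
  by rewrite ncJB; apply: hL; [exact: cl|rewrite normcJ].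
Qed.

Lemma column_regular (c : R) (D : 'I_4 -> bool) (A : 'I_4 -> 'I_4 -> R -> R[i])
    (m M : R -> R) (e : 'I_4 -> R[i]) (g : R[i] -> 'I_4 -> R -> R[i]) k x :
  0 < c -> density m M -> (forall k j, ccont (A k j)) ->
  (forall k j y, nc (A k j y) <= m y) -> (forall k, D k -> e k = 0) ->
  (forall k, nc (e k) <= 1) ->
  (forall k y, ~~ D k -> \sum_(j < 4) A k j y * e j = 0) ->
  (forall w, 0 <= Im w -> column_solution c D A e w (g w)) ->
  regular closed_upper_half upper_half (fun w => g w k x) (e k).
Proof.
move=> c0 dm Ac Am De e1 Ae gs; split.
- move=> z Az t t0; have t2 : 0 < t ^+ 2 by rewrite exprn_gt0.
  have [d d0 hd] := @column_continuous R c D A m M e c0 dm Am De e1 z (g z) x _ Az (gs z Az) t2.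
  exists d => // w Aw wz; have := hd w (g w) Aw (gs w Aw) wz => H.
  have := le_trans (normc_le_energy (fun k y => g w k y - g z k y) k x) H.
  by rewrite ler_pXn2r ?nnegrE ?normc_ge0// ltW.
- have /choice[F' hF'] : forall z : C, exists f' : C, upper_half z -> forall t : R, 0 < t ->
      exists2 d : R, 0 < d & forall w, closed_upper_half w -> w != z -> nc (w - z) <= d ->
      nc ((g w k x - g z k x) / (w - z) - f') <= t.
    move=> z; have [Uz|nU] := pselect (upper_half z); last by exists 0.
    have [g' hg'] := column_derivative c0 dm Ac Am De e1 Uz (gs z (ltW Uz)).
    exists (g' k x) => _ t t0; have [d d0 hd] := hg' k x t t0; exists d => // w Aw wz wd.
    by apply: hd => //; exact: gs.
  by exists F'.
- move=> t t0; have [L hL] := @column_at_infinity R c D A m M e c0 dm Ac Am De e1 Ae x k t t0.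
  by exists L => w Aw; apply: hL => //; exact: gs.
Qed.

Lemma regular_continuous A U F a : regular A U F a -> {within A, continuous F}.
Proof. by case=> cF _ _; exact: within_continuous_normc. Qed.

Lemma regular_cvg A U F a : regular A U F a -> F @ infty_in A --> a.
Proof. by case=> _ _ iF; exact: cvg_infty_in. Qed.

Lemma regular_derivable A U F a :
  (forall z, U z -> exists2 r : R, 0 < r & forall w, nc (w - z) <= r -> A w) ->
  regular A U F a -> forall z, U z -> derivable F z 1.
Proof. by move=> HU [_ [F' dF] _]; exact: derivable_normc HU dF. Qed.

End Regularity.

(** * Jost solutions and the scattering matrix *)

Section Jost.
Context {R : realType}.
Local Notation Re := complex.Re.
Local Notation Im := complex.Im.
Local Notation nc := Normc.normc.
Implicit Types (x y : R).

Let sg k : R := @sigma_row R 0 k.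

Lemma cvanishing_sum (I : Type) (r : seq I) (f : I -> R -> R[i]) :
  (forall i, cvanishing (f i)) -> cvanishing (fun y => \sum_(i <- r) f i y).
Proof.
move=> fv; elim: r => [|i r IH].
  by move=> t t0; exists 0 => y _; rewrite big_nil Normc.normc0 normr0 ltW.
have := cvanishing_add (fv i) IH; congr cvanishing; apply/funext => y.
by rewrite big_cons.
Qed.

Lemma cvanishing_mul (f g : R -> R[i]) :
  cvanishing f -> cvanishing g -> cvanishing (fun y => f y * g y).
Proof.
move=> fv gv; have [A hA] := fv 1 ltr01; apply: cvanishing_le gv; exists A => y /hA.
rewrite ger0_norm ?normc_ge0// Normc.normcM => h.
by rewrite -[leRHS]mul1r ler_wpM2r ?normc_ge0.
Qed.

Lemma cvanishing_prod_limit (f g : R -> R[i]) (a b : R[i]) :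
  cvanishing (fun y => f y - a) -> cvanishing (fun y => g y - b) ->
  cvanishing (fun y => f y * g y - a * b).
Proof.
move=> fv gv.
have := cvanishing_add (cvanishing_mul fv gv)
  (cvanishing_add (cvanishing_scale a gv) (cvanishing_scale b fv)).
congr cvanishing; apply/funext => y; ring.
Qed.

Lemma cvanishing_conj (f : R -> R[i]) : cvanishing f -> cvanishing (fun y => (f y)^*).
Proof. by apply: cvanishing_le; exists 0 => y _; rewrite normcJ. Qed.

(* [J^* J - 1] solves [d' = i nu [sigma, d]], so each entry has constant modulus. *)
Lemma jost_unitary (nu : R) (B J : 'I_4 -> 'I_4 -> R -> R[i]) :
  (forall k j x, is_derive_cplx (J k j) x
     ((0 +i* nu) * (sg k - sg j)%:C * J k j x + \sum_(i < 4) B k i x * J i j x)) ->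
  (forall k j x, (B k j x)^*%C = - B j k x) ->
  (forall k j, cvanishing (fun y => J k j y - (k == j)%:R)) ->
  forall k j x, \sum_(i < 4) (J i k x)^*%C * J i j x = (k == j)%:R.
Proof.
move=> dJ BH vJ k j x.
pose d y : R[i] := \sum_(i < 4) (J i k y)^*%C * J i j y - (k == j)%:R.
pose rho := (0 +i* nu) * (sg k - sg j)%:C.
have dd y : is_derive_cplx d y (rho * d y).
  have h i := cder_mul (cder_conj (dJ i k y)) (dJ i j y).
  apply: cder_eq (cder_sub (cder_sum _ h) (cder_cst _ y)) _.
  rewrite subr0 /d mulrBr.
  have -> : rho * (k == j)%:R = 0.
    rewrite /rho; have [->|_] := eqVneq k j; last by rewrite mulr0.
    by rewrite subrr mulr0 mul0r.
  rewrite subr0 mulr_sumr.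
  transitivity (\sum_(i < 4) (rho * ((J i k y)^*%C * J i j y) +
      (\sum_(a < 4) - ((J a k y)^*%C * B a i y * J i j y) +
       \sum_(a < 4) (J i k y)^*%C * B i a y * J a j y))).
    apply: eq_bigr => i _; rewrite rmorphD /= rmorph_sum /= mulrDl mulrDr.
    rewrite !rmorphM /= mulr_suml mulr_sumr.
    have -> : \sum_(i0 < 4) (B i i0 y * J i0 k y)^*%C * J i j y =
        \sum_(a < 4) - ((J a k y)^*%C * B a i y * J i j y).
      by apply: eq_bigr => a _; rewrite rmorphM /= BH; ring.
    have -> : \sum_(i0 < 4) (J i k y)^*%C * (B i i0 y * J i0 j y) =
        \sum_(a < 4) (J i k y)^*%C * B i a y * J a j y.
      by apply: eq_bigr => a _; rewrite mulrA.
    have -> : 0 +i* (- nu) = - (0 +i* nu) :> R[i] by apply: complex_eq; rewrite /= ?oppr0.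
    have -> : (sg i - sg k) +i* (- 0) = (sg i - sg k)%:C by rewrite oppr0.
    rewrite /rho !rmorphB; ring.
  (* After swapping the two indices in one of the coupling sums, they cancel. *)
  rewrite !big_split /= [X in _ + (X + _)]exchange_big /=.
  rewrite -big_split /= [X in _ + X]big1 ?addr0// => i _.
  by rewrite sumrN addNr.
have vd : cvanishing d.
  have vJc i : cvanishing (fun y => (J i k y)^*%C - (i == k)%:R).
    have := cvanishing_conj (vJ i k); congr cvanishing; apply/funext => y.
    by rewrite rmorphB /= conjc_nat.
  have h i := cvanishing_prod_limit (vJc i) (vJ i j).
  have := cvanishing_sum (index_enum 'I_4) h; congr cvanishing; apply/funext => y.
  rewrite sumrB /d; congr (_ - _); rewrite (bigD1 k)//= eqxx mul1r big1 ?addr0// => i /negPf ->.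
  by rewrite mul0r.
have cst y : y <= x -> nc (d x) ^+ 2 <= nc (d y) ^+ 2.
  move=> yx; apply: (@der_nincr R (fun y => nc (d y) ^+ 2) (fun=> 0) y x yx) => // t _.
  apply: is_derive_eq (der_normc_sqr (dd t)) _.
  have -> : (d t)^*%C * (rho * d t) = (0 +i* (nu * (sg k - sg j) * nc (d t) ^+ 2)).
    rewrite normc_sqr /rho; case: (d t) => p q; apply: complex_eq => /=; ring.
  by rewrite /= mulr0.
have : nc (d x) <= 0.
  apply/ler_addgt0Pr => t t0; rewrite add0r; have [a ha] := vd t t0.
  have yx : Num.min a x <= x by rewrite ge_min lexx orbT.
  have ya : Num.min a x <= a by rewrite ge_min lexx.
  have := ha _ ya; rewrite ger0_norm ?normc_ge0//; apply: le_trans.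
  by rewrite -(@ler_pXn2r _ 2) ?nnegrE ?normc_ge0//; exact: cst.
by move/normc_eq0/eqP; rewrite subr_eq0 => /eqP.
Qed.

Lemma Qmx_entry (q : 'I_3 -> R -> R[i]) x (k j : 'I_4) :
  Qmx q x k j = match unlift 0 k, unlift 0 j with
    | None, Some j' => - q j' x
    | Some k', None => (q k' x)^*
    | _, _ => 0 end.
Proof.
rewrite /Qmx.
have lE (i : 'I_3) : lift 0 i = rshift 1 i :> 'I_4 by apply: val_inj.
have zE : (0 : 'I_4) = lshift 3 (0 : 'I_1) by apply: val_inj.
case: unliftP => [k'|] ->; case: unliftP => [j'|] ->; rewrite ?lE ?zE.
- by transitivity ((0 : 'M[R[i]]_3) k' j'); [exact: block_mxEdr|rewrite mxE].
- transitivity ((\col_(k < 3) (q k x)^* : 'M[R[i]]_(3, 1)) k' 0); first exact: block_mxEdl.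
  by rewrite mxE.
- transitivity ((\row_(j < 3) (- q j x) : 'M[R[i]]_(1, 3)) 0 j'); first exact: block_mxEur.
  by rewrite mxE.
- by transitivity ((0 : 'M[R[i]]_1) 0 0); [exact: block_mxEul|rewrite mxE].
Qed.

Lemma jost_rhs (c1 l : R) (q : 'I_3 -> R -> R[i]) x (J : 'M[R[i]]_4) k j :
  ((0 +i* (c1 * l)) *: (sigma *m J - J *m sigma) + Qmx q x *m J) k j =
  (0 +i* (c1 * l)) * (sg k - sg j)%:C * J k j + \sum_(i < 4) Qmx q x k i * J i j.
Proof.
rewrite mxE; congr (_ + _); last by rewrite mxE.
rewrite mxE /sigma mxE mul_diag_mx mxE mul_mx_diag !mxE rmorphB /=.
by rewrite /sg !mxE; ring.
Qed.

End Jost.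

(** * Unitarity, the columns of [P1], and the product of [P2] and [P1] *)

Section Scattering.
Context {R : realType}.
Local Notation Re := complex.Re.
Local Notation Im := complex.Im.
Local Notation nc := Normc.normc.
Variables (c1 : R) (q : 'I_3 -> R -> R[i]).
Implicit Types (x y l : R).

Let sg k : R := @sigma_row R 0 k.

Let sgE k : sg k = if k == 0 then - 2 else 1.
Proof. by rewrite /sg mxE. Qed.

Lemma Qmx_conj x k j : (Qmx q x k j)^* = - Qmx q x j k.
Proof.
rewrite !Qmx_entry; case: (unlift 0 k) => [k'|]; case: (unlift 0 j) => [j'|].
- by rewrite conjc0 oppr0.
- by rewrite conjcK opprK.
- by rewrite rmorphN.
- by rewrite conjc0 oppr0.
Qed.

Lemma Qmx_normc x k j : nc (Qmx q x k j) <= \sum_(i < 3) nc (q i x).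
Proof.
have S0 : 0 <= \sum_(i < 3) nc (q i x) by apply: sumr_ge0 => i _; exact: normc_ge0.
have Si i : nc (q i x) <= \sum_(i < 3) nc (q i x).
  by rewrite (bigD1 i)//= lerDl; apply: sumr_ge0 => h _; exact: normc_ge0.
rewrite Qmx_entry; case: (unlift 0 k) => [k'|]; case: (unlift 0 j) => [j'|];
  by rewrite ?Normc.normc0 ?normcN ?normcJ.
Qed.

Lemma Qmx_ccont k j : (forall i, ccont (q i)) -> ccont (fun x => Qmx q x k j).
Proof.
move=> qc; under eq_fun do rewrite Qmx_entry.
case: (unlift 0 k) => [k'|]; case: (unlift 0 j) => [j'|].
- exact: ccont_cst.
- exact: ccont_conj.
- exact: ccont_opp.
- exact: ccont_cst.
Qed.

Lemma Qmx_diag x k j : (k == 0) = (j == 0) -> Qmx q x k j = 0.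
Proof.
rewrite Qmx_entry; case: unliftP => [k'|] ->; case: unliftP => [j'|] -> //.
Qed.

Section Solutions.
Variables (Jm Jp : R -> R -> 'M[R[i]]_4).
Hypotheses (Jm_jost : is_jost c1 q -oo Jm) (Jp_jost : is_jost c1 q +oo Jp).

Let Jm_der l k j x : is_derive_cplx (fun y => Jm y l k j) x
  ((0 +i* (c1 * l)) * (sg k - sg j)%:C * Jm x l k j + \sum_(i < 4) Qmx q x k i * Jm x l i j).
Proof. by apply: cder_eq ((Jm_jost l).1 x k j) _; exact: jost_rhs. Qed.

Let Jp_der l k j x : is_derive_cplx (fun y => Jp (- y) l k j) x
  ((0 +i* (- (c1 * l))) * (sg k - sg j)%:C * Jp (- x) l k j +
   \sum_(i < 4) (- Qmx q (- x) k i) * Jp (- x) l i j).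
Proof.
apply: cder_eq (cder_reflect ((Jp_jost l).1 (- x) k j)) _.
rewrite jost_rhs opprD -sumrN; congr (_ + _); last by apply: eq_bigr => i _; rewrite mulNr.
have -> : 0 +i* (- (c1 * l)) = - (0 +i* (c1 * l)) :> R[i].
  by apply: complex_eq; rewrite /= ?oppr0.
by rewrite !mulNr.
Qed.

Let Jm_van l k j : cvanishing (fun y => Jm y l k j - (k == j)%:R).
Proof. by have := cvg_Ny_vanishing ((Jm_jost l).2 k j); rewrite mxE. Qed.

Let Jp_van l k j : cvanishing (fun y => Jp (- y) l k j - (k == j)%:R).
Proof. by have := cvg_y_vanishing ((Jp_jost l).2 k j); rewrite mxE. Qed.

Definition adjmx (J : 'M[R[i]]_4) : 'M[R[i]]_4 := \matrix_(k, j) (J j k)^*.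

Lemma unitary_invmx (J : 'M[R[i]]_4) :
  (forall k j, \sum_(i < 4) (J i k)^*%C * J i j = (k == j)%:R) ->
  J \in unitmx /\ invmx J = adjmx J.
Proof.
move=> H; have HJ : adjmx J *m J = 1%:M.
  apply/matrixP => k j; rewrite mxE [RHS]mxE -H.
  by apply: eq_bigr => i _; rewrite mxE.
have [_ uJ] := mulmx1_unit HJ; split => //.
by rewrite -[RHS]mulmx1 -(mulmxV uJ) mulmxA HJ mul1mx.
Qed.

Lemma Jm_unitary x l : Jm x l \in unitmx /\ invmx (Jm x l) = adjmx (Jm x l).
Proof.
apply: unitary_invmx => k j.
apply: (@jost_unitary R (c1 * l) (fun k j y => Qmx q y k j) (fun k j y => Jm y l k j)).
- by move=> a b y; exact: Jm_der.
- by move=> a b y; exact: Qmx_conj.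
- by move=> a b; exact: Jm_van.
Qed.

Lemma Jp_unitary x l : Jp x l \in unitmx /\ invmx (Jp x l) = adjmx (Jp x l).
Proof.
apply: unitary_invmx => k j.
have := @jost_unitary R (- (c1 * l)) (fun k j y => - Qmx q (- y) k j)
  (fun k j y => Jp (- y) l k j) _ _ _ k j (- x).
rewrite opprK; apply.
- by move=> a b y; exact: Jp_der.
- by move=> a b y; rewrite rmorphN /= Qmx_conj.
- by move=> a b; exact: Jp_van.
Qed.

Lemma P2_adj x l : P2 Jm Jp x l = adjmx (P1 Jm Jp x l).
Proof.
apply/matrixP => k j; rewrite !mxE.
have [_ ->] := Jm_unitary x l; have [_ ->] := Jp_unitary x l.
by case: ifP => k0; rewrite mxE.
Qed.

Lemma Jm_column l : column_solution (3 * c1) (fun k => k != 0)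
  (fun k j y => Qmx q y k j) (fun k => (k == 0)%:R) l%:C (fun k y => Jm y l k 0).
Proof.
split=> [k x|k]; last exact: Jm_van.
apply: cder_eq (Jm_der l k 0 x) _; rewrite addr0; congr (_ + _).
rewrite /rate !sgE eqxx; case: eqP => [->|_] /=.
  by rewrite subrr mulr0 !mul0r.
congr (_ * _); apply: complex_eq => /=; ring.
Qed.

(** Row 0 has eigenvalue gap -3 against column [j], and the reflection contributes another sign, so
    the rate is the one met for [Jm]. *)
Lemma Jp_column l j : j != 0 -> column_solution (3 * c1) (fun k => k == 0)
  (fun k i y => - Qmx q (- y) k i) (fun k => (k == j)%:R) l%:C (fun k y => Jp (- y) l k j).
Proof.
move=> j0; split=> [k x|k]; last exact: Jp_van.
apply: cder_eq (Jp_der l k j x) _; rewrite addr0; congr (_ + _).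
rewrite /rate !sgE (negPf j0); case: eqP => [->|_] /=; last first.
  by rewrite subrr mulr0 !mul0r.
congr (_ * _); apply: complex_eq => /=; ring.
Qed.

End Solutions.

Lemma expiD (a b : R) : expi a * expi b = expi (a + b).
Proof. by rewrite /expi cosD sinD; apply: complex_eq => /=; ring. Qed.

Lemma Emx_mulN x l : Emx c1 x l *m Emx c1 (- x) l = 1%:M.
Proof.
apply/matrixP => k j; rewrite /Emx mul_diag_mx !mxE.
have [->|_] := eqVneq k j; last by rewrite mulr0.
rewrite mulr1n expiD mulrN subrr.
by rewrite /expi cos0 sin0.
Qed.

Lemma Emx_conj x l (S : 'M[R[i]]_4) k j :
  (Emx c1 x l *m S *m Emx c1 (- x) l) k j = S k j * expi (c1 * l * (sg k - sg j) * x).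
Proof.
rewrite /Emx mul_mx_diag mxE mul_diag_mx !mxE -/(sg k).
rewrite mulrAC expiD mulrC; congr (_ * expi _); rewrite /sg !mxE; ring.
Qed.

(** An entry pairing a row and a column from the same Jost matrix is an entry of the identity. A
    mixed one belongs to the conjugate of [S] or of its inverse by [E], which multiplies it by an
    exponential of the eigenvalue gap, 3 or -3. *)
Lemma P2_mul_P1 (Jm Jp : R -> R -> 'M[R[i]]_4) (S : R -> 'M[R[i]]_4) x l :
  (forall x l, Jm x l \in unitmx) -> (forall x l, Jp x l \in unitmx) ->
  is_scattering c1 Jm Jp S -> P2 Jm Jp x l *m P1 Jm Jp x l = Gmx c1 S x l.
Proof.
move=> um up Sc; have um' := um x l; have up' := up x l.
set E := Emx c1 x l; set E' := Emx c1 (- x) l.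
have EE' : E *m E' = 1%:M by exact: Emx_mulN.
have E'E : E' *m E = 1%:M by exact: mulmx1C.
have hS := Sc x l; rewrite -/E in hS.
have uE : E \in unitmx by have [] := mulmx1_unit EE'.
have JmE : Jm x l = Jp x l *m (E *m S l *m E').
  by rewrite !mulmxA -hS -mulmxA EE' mulmx1.
have pm : invmx (Jp x l) *m Jm x l = E *m S l *m E' by rewrite JmE mulKmx.
have uS : S l \in unitmx.
  have : Jp x l *m E *m S l \in unitmx by rewrite -hS unitmx_mul um'.
  by rewrite unitmx_mul => /andP[].
have mp : invmx (Jm x l) *m Jp x l = E *m invmx (S l) *m E'.
  have -> : Jp x l = Jm x l *m (E *m invmx (S l) *m E').
    rewrite JmE -!mulmxA (mulmxA E') E'E mul1mx (mulmxA (S l)) (mulmxV uS) mul1mx.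
    by rewrite EE' mulmx1.
  by rewrite mulKmx.
apply/matrixP => k j; rewrite [RHS]mxE.
(* The entry [(k, j)] involves a single row and a single column, so each factor may be replaced by
   the full matrix they come from. *)
pose L := if k == 0 then Jm x l else Jp x l; pose N := if j == 0 then Jm x l else Jp x l.
have -> : (P2 Jm Jp x l *m P1 Jm Jp x l) k j = (invmx L *m N) k j.
  rewrite !mxE; apply: eq_bigr => i _; rewrite !mxE /L /N.
  by case: (k == 0); case: (j == 0).
rewrite /L /N; have [->|k0] := eqVneq k 0; have [->|j0] := eqVneq j 0.
- by rewrite mulVmx// mxE eqxx.
- rewrite mp Emx_conj !sgE (negPf j0) eqxx.
  by congr (_ * expi _); ring.
- rewrite (negPf k0) pm Emx_conj !sgE (negPf k0) eqxx.
  by congr (_ * expi _); ring.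
- by rewrite mulVmx// mxE; case: eqP.
Qed.

End Scattering.

Theorem theorem3p1 (R : realType) (eps c1 : R) (q : 'I_3 -> R -> R[i])
    (Jm Jp : R -> R -> 'M[R[i]]_4) (S : R -> 'M[R[i]]_4)
    (eps_gt0 : 0 < eps) (c1E : c1 = (12 * eps)^-1)
    (q_cont : forall k : 'I_3, continuous (q k : R -> R[i]^o))
    (q_int : forall k : 'I_3, abs_integrable (q k))
    (Jm_jost : is_jost c1 q -oo Jm) (Jp_jost : is_jost c1 q +oo Jp)
    (S_scat : is_scattering c1 Jm Jp S) :
  exists Pp Pm : R -> R[i] -> 'M[R[i]]_4,
    forall x : R,
      [/\ continuous_extension closed_upper_half (P1 Jm Jp x) (Pp x) /\
          continuous_extension closed_lower_half (P2 Jm Jp x) (Pm x),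
          analytic_in upper_half (Pp x) /\ analytic_in lower_half (Pm x),
          forall l : R, Pm x l%:C *m Pp x l%:C = Gmx c1 S x l
        & tends_to_id_in closed_upper_half (Pp x) /\
          tends_to_id_in closed_lower_half (Pm x)].
Proof.
have c0 : 0 < 3 * c1 by rewrite c1E mulr_gt0// invr_gt0 mulr_gt0.
have qc k : ccont (q k) by exact/continuous_ccont/q_cont.
have /choice[M0 /choice[M1 hM]] : forall k, exists M M' : R -> R,
    density (fun x => Normc.normc (q k x)) M /\ density (fun x => Normc.normc (q k (- x))) M'.
  move=> k; apply: (integrable_density (ccont_normc (qc k))) => [x|]; first exact: normc_ge0.
  exact: q_int.
have dm := density_sum (index_enum 'I_3) (fun k => (hM k).1).
have dp := density_sum (index_enum 'I_3) (fun k => (hM k).2).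
have delta1 (j k : 'I_4) : Normc.normc ((k == j)%:R : R[i]) <= 1.
  by case: (k == j); rewrite ?Normc.normc1 ?Normc.normc0.
have Qm_c k j : ccont (fun x => Qmx q x k j) by exact: Qmx_ccont.
have Qp_c k j : ccont (fun x => - Qmx q (- x) k j).
  exact/ccont_opp/(ccont_reflect (Qm_c k j)).
have Qm_n k j y := Qmx_normc q y k j.
have Qp_n k j y : Normc.normc (- Qmx q (- y) k j) <= \sum_(i < 3) Normc.normc (q i (- y)).
  by rewrite normcN; exact: Qmx_normc.
have Dm (k : 'I_4) : k != 0 -> (k == 0)%:R = 0 :> R[i] by move=> /negPf ->.
have Dp (j k : 'I_4) : j != 0 -> k == 0 -> (k == j)%:R = 0 :> R[i].
  by move=> j0 /eqP ->; rewrite eq_sym (negPf j0).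
have Am (k : 'I_4) y : ~~ (k != 0) -> \sum_(j < 4) Qmx q y k j * (j == 0)%:R = 0.
  rewrite negbK => /eqP ->; apply: big1 => j _; have [->|_] := eqVneq j 0.
    by rewrite Qmx_diag// mul0r.
  by rewrite mulr0.
have Ap (j : 'I_4) (k : 'I_4) y : j != 0 -> ~~ (k == 0) ->
    \sum_(i < 4) (- Qmx q (- y) k i) * (i == j)%:R = 0.
  move=> j0 k0; apply: big1 => i _; have [->|_] := eqVneq i j; last by rewrite mulr0.
  by rewrite Qmx_diag ?oppr0 ?mul0r// (negPf j0) (negPf k0).
(* The zero family below the real axis is a dummy value, outside the region where the extension is
   examined. *)
have /choice[gm hgm] : forall w : R[i], exists g, 0 <= complex.Im w ->
    column_solution (3 * c1) (fun k => k != 0) (fun k j y => Qmx q y k j)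
      (fun k => (k == 0)%:R) w g.
  move=> w; have [w0|_] := leP 0 (complex.Im w); last by exists (fun _ _ => 0).
  by have [g] := column_exists c0 dm Qm_c Qm_n Dm (delta1 0) w0; exists g.
have /choice[gp hgp] : forall jw : 'I_4 * R[i], exists g, jw.1 != 0 -> 0 <= complex.Im jw.2 ->
    column_solution (3 * c1) (fun k => k == 0) (fun k j y => - Qmx q (- y) k j)
      (fun k => (k == jw.1)%:R) jw.2 g.
  move=> [j w] /=; have [->|j0] := eqVneq j 0; first by exists (fun _ _ => 0).
  have [w0|_] := leP 0 (complex.Im w); last by exists (fun _ _ => 0).
  by have [g] := column_exists c0 dp Qp_c Qp_n (fun k => Dp j k j0) (delta1 j) w0; exists g.
pose Pp x w : 'M[R[i]]_4 :=
  \matrix_(k, j) (if j == 0 then gm w k x else gp (j, w) k (- x)).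
pose Pm x w : 'M[R[i]]_4 := adjmx (Pp x w^*).
have Pp_reg x k j : regular closed_upper_half upper_half (fun w => Pp x w k j) (k == j)%:R.
  rewrite /Pp; under eq_fun do rewrite mxE; have [->|j0] := eqVneq j 0.
    exact: (column_regular k x c0 dm Qm_c Qm_n Dm (delta1 0) Am hgm).
  apply: (column_regular k (- x) c0 dp Qp_c Qp_n (fun k => Dp j k j0) (delta1 j)
    (fun k y => Ap j k y j0) (fun w => hgp (j, w) j0)).
have Pm_reg x k j : regular closed_lower_half lower_half (fun w => Pm x w k j) (k == j)%:R.
  have := regular_conj (Pp_reg x j k); rewrite conjc_nat eq_sym.
  rewrite (_ : (fun w => Pm x w k j) = fun w => (Pp x w^* j k)^*)//.
  by apply/funext => w; rewrite [LHS]mxE.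
(* For real [l] the given Jost columns are column solutions themselves, so uniqueness identifies
   them with the constructed ones. *)
have PpE x l : Pp x l%:C = P1 Jm Jp x l.
  have l0 : 0 <= complex.Im l%:C by exact: lexx.
  apply/matrixP => k j; rewrite !mxE; case: eqP => [->|/eqP j0].
    exact: (column_unique c0 dm Qm_n k x l0 (hgm l%:C l0) (Jm_column Jm_jost l)).
  have := column_unique c0 dp Qp_n k (- x) l0 (hgp (j, l%:C) j0 l0)
    (Jp_column Jp_jost l j0).
  by rewrite opprK.
have PmE x l : Pm x l%:C = P2 Jm Jp x l.
  by rewrite /Pm conjc_real PpE (P2_adj Jm_jost Jp_jost).
have one k j : (1%:M : 'M[R[i]]_4) k j = (k == j)%:R by rewrite mxE.
exists Pp, Pm => x; split.
- split; split=> [|k j].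
  + exact: PpE.
  + exact: regular_continuous (Pp_reg x k j).
  + exact: PmE.
  + exact: regular_continuous (Pm_reg x k j).
- split=> z k j.
  + exact: regular_derivable upper_half_interior (Pp_reg x k j) z.
  + exact: regular_derivable lower_half_interior (Pm_reg x k j) z.
- move=> l; rewrite PpE PmE; apply: P2_mul_P1 => // y m.
    exact: (Jm_unitary Jm_jost y m).1.
  exact: (Jp_unitary Jp_jost y m).1.
- by split=> k j; rewrite one; [exact: regular_cvg (Pp_reg x k j)|exact: regular_cvg (Pm_reg x k j)].
Qed.
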